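(* For every integer $n\geq 2$, the determinant $\det(\tilde{G}_{n}^{Mb_{n,1}})$ is divisible by $S_1(d)^{2k}$, where $k=\binom{2n}{n-2}$ and $S_1(d)=d$.
   Context: Model the Möbius band $Mb$ as an annulus whose inner boundary circle is replaced by a crosscap (antipodal points of the inner circle are identified); its boundary is the outer circle, on which $2n$ marked points $x_1,\dots,x_{2n}$ are fixed in cyclic order. A crossingless connection is a collection of $n$ pairwise disjoint properly embedded arcs in $Mb$ joining the $2n$ marked points in pairs, considered up to isotopy fixing the boundary. $Mb_{n,1}$ is the set of all crossingless connections in which exactly one arc (curve) intersects the crosscap (this arc passes through it once), while the other $n-1$ arcs are disjoint from the crosscap. It has $\binom{2n}{n-1}$ elements $m_1,\dots,m_{\binom{2n}{n-1}}$. (An element is described by the $n-1$ arcs disjoint from the crosscap, each travelling counterclockwise around the crosscap from one marked point to another, together with the two remaining marked points, which are joined to each other through the crosscap.) Bilinear form. Given $m_i,m_j$, glue the Möbius band containing $m_i$ to the Möbius band containing the inversion of $m_j$ along their boundary circles, matching marked points with the same label. The result is a Klein bottle (an annulus with one crosscap at each end, one coming from $m_i$ and one from $m_j$) containing a collection of disjoint simple closed curves. Set $\langle m_i,m_j\rangle_{Mb}=d^{a}x^{b}y^{c}z^{e}w^{h}\in\mathbb{Z}[d,w,x,y,z]$, where $a$ is the number of homotopically trivial curves; $b$ is the number of curves passing through the crosscap of $m_i$ but not that of $m_j$; $c$ is the number of curves passing through the crosscap of $m_j$ but not that of $m_i$; $e$ is the number of homotopically nontrivial curves passing through neither crosscap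 (i.e. curves separating the two crosscaps); and $h$ is the number of curves passing through both crosscaps. The Gram matrix is $G_{n}^{Mb_{n,1}}=(\langle m_i,m_j\rangle_{Mb})_{1\leq i,j\leq\binom{2n}{n-1}}$, and $\tilde{G}_{n}^{Mb_{n,1}}$ is the matrix obtained from it by substituting $y=0$ and $w=1$. Divisibility is in the polynomial ring $\mathbb{Z}[d,x,z]$ in which $\det(\tilde{G}_{n}^{Mb_{n,1}})$ lies. $S_n(d)$ denotes the Chebyshev polynomial of the second kind: $S_0(d)=1$, $S_1(d)=d$, $S_n(d)=d\,S_{n-1}(d)-S_{n-2}(d)$. *)

(* Defs.v *)
From HB Require Import structures.
From mathcomp Require Import all_boot all_order all_algebra.
From mathcomp Require Import mpoly.

Set Implicit Arguments.
Unset Strict Implicit.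
Unset Printing Implicit Defensive.

Import GRing.Theory.
Local Open Scope ring_scope.

(* The 2n marked points on the boundary circle, in counterclockwise order:
   x_{i+1} in the usual numbering is the ordinal i. *)
Notation point n := 'I_(2 * n).

(* An arc disjoint from the crosscap is determined up to isotopy by the ordered
   pair (a, b) such that it travels counterclockwise around the crosscap
   from a to b. *)
Notation arc n := (point n * point n)%type.

(* The number of steps from u to v counterclockwise along the boundary. *)
Definition ccw n (u v : point n) : nat := ((v + (2 * n - u)) %% (2 * n))%N.

(* The arc (a, b) cuts off a disk, not containing the crosscap, that meets the
   boundary circle in the interval running counterclockwise from a to b.
   [under a] is the set of marked points of this closed interval, and [inner a]
   that of its interior. *)
Definition under n (a : arc n) : {set point n} :=
  [set v | (ccw a.1 v <= ccw a.1 a.2)%N].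
Definition inner n (a : arc n) : {set point n} :=
  under a :\: [set a.1; a.2].

(* Two arcs disjoint from the crosscap have disjoint realizations iff the
   intervals that they cut off are disjoint or strictly nested. *)
Definition disjoint_arcs n (a b : arc n) : bool :=
  [|| [disjoint under a & under b], under a \subset inner b
    | under b \subset inner a].

(* A crossingless connection with exactly one arc through the crosscap is
   encoded by the set A of its other arcs.  The marked points that are not
   endpoints of arcs in A are the endpoints of the arc through the crosscap. *)
Definition through n (A : {set arc n}) : {set point n} :=
  [set v | [forall a in A, (v != a.1) && (v != a.2)]].

(* The last clause says that the arc through the crosscap avoids the other
   arcs: its endpoints lie outside the disks that these cut off.  Up to
   isotopy, there is then exactly one such simple arc crossing the crosscap
   once. *)
Definition Mb n : {set {set arc n}} :=
  [set A : {set arc n} |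
    [&& #|A| == n.-1,
        [forall a in A, a.1 != a.2],
        [forall a in A, [forall b in A, (a != b) ==> disjoint_arcs a b]]
      & [forall a in A, [disjoint through A & under a]]]].

(* [joined A u v]: some arc of the connection A has endpoints u and v. *)
Definition joined n (A : {set arc n}) (u v : point n) : bool :=
  [|| (u, v) \in A, (v, u) \in A
    | [&& u != v, u \in through A & v \in through A]].

Definition mate n (A : {set arc n}) (u : point n) : point n :=
  odflt u [pick v | joined A u v].

(* The angle, in units of 1/(2n) turn counterclockwise around the crosscap,
   swept by the arc of A at u when it is traversed starting from u.  The value
   for the arc through the crosscap is a dummy. *)
Definition sweep n (A : {set arc n}) (u : point n) : int :=
  let v := mate A u in
  if (u, v) \in A then (ccw u v)%:Z
  else if (v, u) \in A then - (ccw v u)%:Z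
  else 0.

(* Gluing A to the inversion of B (inversion exchanges the two boundary sides
   but preserves angles, hence the counterclockwise direction): each curve is
   represented by the set of marked points that it contains. *)
Definition curve n (A B : {set arc n}) (u : point n) : {set point n} :=
  [set v | connect [rel s t | joined A s t || joined B s t] u v].
Definition curves n (A B : {set arc n}) : {set {set point n}} :=
  [set curve A B u | u : point n].

Definition crosses n (A : {set arc n}) (C : {set point n}) : bool :=
  ~~ [disjoint C & through A].

(* The total angle swept along the curve through u, traversed from u along its
   arc in A, then along an arc in B, and so on until it closes up.  The orbit
   lists the points from which an arc in A is entered. *)
Definition winding n (A B : {set arc n}) (u : point n) : int :=
  \sum_(v <- orbit (mate B \o mate A) u) (sweep A v + sweep B (mate A v)).

(* A curve passing through neither crosscap lies in the annulus between them;
   it is homotopically trivial iff its winding number is 0, and otherwise it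
   separates the two crosscaps.  The choice of base point and direction only
   affects the sign of the winding number. *)
Definition winds n (A B : {set arc n}) (C : {set point n}) : bool :=
  [exists u in C, winding A B u != 0].

(* Curves passing through a crosscap are never homotopically trivial. *)
Definition nb_trivial n (A B : {set arc n}) : nat :=
  #|[set C in curves A B | [&& ~~ crosses A C, ~~ crosses B C & ~~ winds A B C]]|.
Definition nb_left n (A B : {set arc n}) : nat :=
  #|[set C in curves A B | crosses A C && ~~ crosses B C]|.
Definition nb_right n (A B : {set arc n}) : nat :=
  #|[set C in curves A B | crosses B C && ~~ crosses A C]|.
Definition nb_separating n (A B : {set arc n}) : nat :=
  #|[set C in curves A B | [&& ~~ crosses A C, ~~ crosses B C & winds A B C]]|.
Definition nb_both n (A B : {set arc n}) : nat :=
  #|[set C in curves A B | crosses A C && crosses B C]|.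

(* Z[d, w, x, y, z], with its five variables in this order. *)
Definition var5 (i : nat) (lt_i5 : (i < 5)%N) : {mpoly int[5]} :=
  'X_(Ordinal lt_i5).
Definition pd := @var5 0 isT.
Definition pw := @var5 1 isT.
Definition px := @var5 2 isT.
Definition py := @var5 3 isT.
Definition pz := @var5 4 isT.

(* Z[d, x, z], with its three variables in this order. *)
Definition var3 (i : nat) (lt_i3 : (i < 3)%N) : {mpoly int[3]} :=
  'X_(Ordinal lt_i3).
Definition qd := @var3 0 isT.
Definition qx := @var3 1 isT.
Definition qz := @var3 2 isT.

Definition Mb_form n (A B : {set arc n}) : {mpoly int[5]} :=
  pd ^+ nb_trivial A B * px ^+ nb_left A B * py ^+ nb_right A B
  * pz ^+ nb_separating A B * pw ^+ nb_both A B.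

(* The enumeration m_1, m_2, ... of the connections is the one of the finite
   type; the determinant does not depend on it. *)
Definition gram n : 'M[{mpoly int[5]}]_#|Mb n| :=
  \matrix_(i, j) Mb_form (enum_val i) (enum_val j).

Definition subst_y0_w1 (p : {mpoly int[5]}) : {mpoly int[3]} :=
  comp_mpoly [tuple qd; 1; qx; 0; qz] p.

Definition gram_tilde n : 'M[{mpoly int[3]}]_#|Mb n| :=
  map_mx subst_y0_w1 (gram n).

(* The Chebyshev polynomial of the second kind S_k, evaluated at t. *)
Fixpoint chebyshevS (R : comNzRingType) (k : nat) (t : R) : R :=
  match k with
  | 0 => 1
  | 1 => t
  | (k'.+1 as k1).+1 => t * chebyshevS k1 t - chebyshevS k' t
  end.

(* Main.v *)
Require Import Defs.
From mathcomp Require Import all_boot all_order all_algebra.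
From mathcomp Require Import perm mpoly zify ring.
(* Undoes the shadowing of [arc] by [path.arc]. *)
Import Defs.
Set Implicit Arguments.
Unset Strict Implicit.
Unset Printing Implicit Defensive.
Import Order.TTheory GRing.Theory Num.Theory.
Local Open Scope ring_scope.

(** After the substitution [y = 0], [w = 1] only pairs of connections whose arcs
    through the crosscaps lie on a common curve contribute, and all other curves
    are then trivial.  Over an extension in which [d = q + 1 / q], the Gram
    matrix is, up to a power of [q], a product [Phi * Phi^T], where [Phi] expands
    a connection over the orientations of its arcs: a trivial circle contributes
    [q + 1 / q] because its turning number is 1 or -1, and the curve through both
    crosscaps contributes 1 because its turning number is 0.

    A connection [D] with [n - 2] arcs and four free ends has four closings, by an
    arc joining consecutive ends; weighted by the powers of [- q], the four
    corresponding rows of [Phi] add up to a multiple of [1 - q ^ 4], hence of [d].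
    Exchanging one closing of every [D] for this sum is a unitriangular change of
    basis, after which [binomial (2 n) (n - 2)] rows of [Phi] are divisible by
    [d]; in [det (Phi * Phi^T)] each of them counts twice. *)

(** * Closed walks of two involutions *)

(** The encoding is combinatorial, so the two topological inputs are proved on integers. A curve is
    unrolled to the universal cover of the boundary circle, where arcs become half-circles above or
    below a line, and its turning number is read off from signs of differences of positions. The
    curves beside one that joins the two crosscaps have winding number 0, because each of two signed
    counts of passages is constant along the joining curve and vanishes at one of its ends. The
    coefficients of the relation arise as follows. Consecutive closings share an end, which is the
    target of one (weight [q]) and the source of the other (weight 1), so a factor [- q] between
    them cancels the two terms. Once around the four ends these factors multiply to [q ^ 4] instead
    of 1, and the defect [1 - q ^ 4] is a multiple of [q + 1 / q]. The closing that is exchanged is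
    the one across the cut between the last and the first marked point; the number of arcs across
    this cut orders the basis. Divisibility returns to the original ring because the extension is
    free over it with basis [1, q]. *)

Section Walk.

Variables (T : finType) (f g : T -> T).
Hypotheses (fK : involutive f) (gK : involutive g).
Hypotheses (f_fix : forall v, f v != v) (g_fix : forall v, g v != v).

Definition walk (u : T) (i : nat) : T :=
  if odd i then f (iter i./2 (g \o f) u) else iter i./2 (g \o f) u.

Definition walk_length (u : T) : nat := (order (g \o f) u).*2.

Lemma walk0 u : walk u 0 = u. Proof. by []. Qed.

Lemma walkS u i : walk u i.+1 = if odd i then g (walk u i) else f (walk u i).
Proof.
rewrite /walk /= uphalf_half; case: (odd i) => //=.
Qed.

Lemma walk_double u i : walk u i.*2 = iter i (g \o f) u.
Proof. by rewrite /walk odd_double doubleK. Qed.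

Lemma comp_involutive_inj : injective (g \o f).
Proof. by apply: inj_comp; apply: inv_inj. Qed.

Lemma walk_length_gt0 u : (0 < walk_length u)%N.
Proof. by rewrite double_gt0 order_gt0. Qed.

Lemma walk_periodic u i : walk u (i + walk_length u) = walk u i.
Proof.
rewrite /walk oddD odd_double addbF halfD odd_double andbF add0n doubleK.
by rewrite iterD (iter_order comp_involutive_inj).
Qed.

Lemma walk_last u : g (walk u (walk_length u).-1) = u.
Proof.
have := walkS u (walk_length u).-1; rewrite prednK ?walk_length_gt0 //.
have -> : odd (walk_length u).-1.
  have := walk_length_gt0 u; rewrite /walk_length; lia.
by move=> <-; apply: walk_periodic u 0.
Qed.

Lemma iter_reflect k v : f (iter k (g \o f) v) = iter k (f \o g) (f v).
Proof. by elim: k => //= k ->. Qed.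

Lemma iter_unreflect k v : iter k (f \o g) (iter k (g \o f) v) = v.
Proof.
by elim: k v => [|k IHk] v //; rewrite iterSr [iter k.+1 _ v]iterS /= gK fK IHk.
Qed.

(** A walk from [v] to [f v] would coincide with its own reversal, and its middle would be a fixed
    point of [f] (even [k]) or of [g] (odd [k]). *)
Lemma iter_neq_reflect k v : iter k (g \o f) v != f v.
Proof.
apply/eqP => E.
have key j : (j <= k)%N -> iter (k - j) (g \o f) v = f (iter j (g \o f) v).
  move=> le_jk; rewrite iter_reflect -E -{2}(subnKC le_jk) iterD.
  by rewrite iter_unreflect.
case: (boolP (odd k)) => odd_k; last first.
  have /eqP := key k./2 ltac:(lia); have -> : (k - k./2 = k./2)%N by lia.
  by rewrite eq_sym; apply/negP.
have := key k./2 ltac:(lia); have -> : (k - k./2 = k./2.+1)%N by lia.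
by move=> /= /eqP; apply/negP.
Qed.

(** Times of equal parity are separated by the order of [g \o f], times of different parity by
    [iter_neq_reflect]. *)
Lemma walk_inj u i j : (i < walk_length u)%N -> (j < walk_length u)%N ->
  walk u i = walk u j -> i = j.
Proof.
have iter_inj k l : (k < order (g \o f) u)%N -> (l < order (g \o f) u)%N ->
    iter k (g \o f) u = iter l (g \o f) u -> k = l.
  by move=> lt_k lt_l E; rewrite -(findex_iter lt_k) E findex_iter.
have no_mix k l : iter k (g \o f) u <> f (iter l (g \o f) u).
  move=> E; case: (leqP l k) => [le_lk|/ltnW le_kl].
    by have /eqP := iter_neq_reflect (k - l) (iter l (g \o f) u);
      rewrite -iterD subnK.
  have /eqP := iter_neq_reflect (l - k) (iter k (g \o f) u).
  by rewrite -iterD subnK // E fK.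
rewrite /walk_length => lt_i lt_j; rewrite /walk.
have := odd_double_half i; have := odd_double_half j.
case: (odd i); case: (odd j) => /= Ej Ei.
- by move/(inv_inj fK)/iter_inj => E; have := E ltac:(lia) ltac:(lia); lia.
- by move/esym/no_mix.
- by move/no_mix.
- by move/iter_inj => E; have := E ltac:(lia) ltac:(lia); lia.
Qed.

Lemma walk_mod u i : walk u (i %% walk_length u) = walk u i.
Proof.
rewrite {2}(divn_eq i (walk_length u)) addnC.
elim: (i %/ _)%N => [|k IHk]; first by rewrite addn0.
by rewrite mulSn addnCA addnC walk_periodic.
Qed.

Definition glued : rel T := [rel s t | (f s == t) || (g s == t)].

Lemma connect_walk u i : connect glued u (walk u i).
Proof.
elim: i => [|i IHi]; first exact: connect0.
apply: connect_trans IHi (connect1 _); rewrite /= walkS.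
by rewrite /glued /=; case: (odd i); rewrite eqxx ?orbT.
Qed.

Lemma walk_closed u i (e : T -> T) : e = f \/ e = g ->
  exists j, e (walk u i) = walk u j.
Proof.
move=> e_fg.
(* Time 0 has no predecessor, so it is replaced by a full period. *)
wlog i_gt0 : i / (0 < i)%N.
  move=> W; rewrite -(walk_periodic u i); apply: W.
  by rewrite addn_gt0 walk_length_gt0 orbT.
case: e_fg => ->; case: (boolP (odd i)) => odd_i.
- exists i.-1; rewrite -[in LHS](prednK i_gt0) walkS.
  have -> : odd i.-1 = false by lia.
  by rewrite fK.
- by exists i.+1; rewrite walkS (negbTE odd_i).
- by exists i.+1; rewrite walkS odd_i.
exists i.-1; rewrite -[in LHS](prednK i_gt0) walkS.
have -> : odd i.-1 by lia.
by rewrite gK.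
Qed.

Lemma connect_gluedP u v :
  reflect (exists2 i, (i < walk_length u)%N & v = walk u i) (connect glued u v).
Proof.
apply: (iffP idP) => [/connectP[p]|[i _ ->]]; last exact: connect_walk.
suff: forall w p, (exists i, w = walk u i) -> path glued w p ->
    exists i, last w p = walk u i.
  move=> H path_p ->; have [i ->] := H u p (ex_intro _ 0%N erefl) path_p.
  exists (i %% walk_length u)%N; last by rewrite walk_mod.
  by rewrite ltn_pmod ?walk_length_gt0.
move=> w {}p; elim: p w => //= x p IHp w [i ->] /andP[/orP[]/eqP <- path_p];
apply: IHp path_p; apply: walk_closed; by [left|right].
Qed.

Lemma connect_glued_sym : connect_sym glued.
Proof.
apply: sym_connect_sym => s t /=.
by congr orb; apply/eqP/eqP => <-; rewrite ?fK ?gK.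
Qed.

End Walk.

(** * Discrete turning numbers *)

Section Turning.

Lemma alternating_sum_even (F : nat -> int) m :
  (forall i, (i < m)%N -> F i.*2 = F i.*2.+1) ->
  \sum_(0 <= k < m.*2) (-1) ^+ k * F k = 0.
Proof.
elim: m => [|m IHm] eqF; first by rewrite big_nil.
rewrite doubleS !big_nat_recr //= IHm => [|i lt_im]; last by apply: eqF; lia.
rewrite eqF // exprS; ring.
Qed.

Lemma alternating_sum_odd (F : nat -> int) m :
  (forall i, (i < m)%N -> F i.*2.+1 = F i.*2.+2) ->
  \sum_(0 <= k < m.*2.+1) (-1) ^+ k * F k = F 0%N.
Proof.
elim: m => [|m IHm] eqF; first by rewrite big_nat1 mul1r.
rewrite doubleS big_nat_recr //= big_nat_recr //= IHm => [|i lt_im]; last by apply: eqF; lia.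
rewrite eqF // !exprS; ring.
Qed.

Variable x : nat -> int.
Local Notation s i j := (sgz (x j - x i)).

(** Every step is a half-turn. Its sense depends on the direction of the step and on the side of the
    axis, which alternates. *)
Definition turning (L : nat) : int := \sum_(0 <= i < L) (-1) ^+ i * s i i.+1.

(* Hopf's secant argument: [s i j] is the direction of the secant from the [i]-th
   to the [j]-th crossing with the axis.  The even steps are arcs above the axis,
   the odd ones below; two arcs on the same side have disjoint or nested
   intervals, so that the mixed difference of [s] at them vanishes, and the
   alternating sum of these differences telescopes to the boundary. *)
Lemma turning_partial L :
  (forall i j, (i < j < L)%N -> odd i = odd j ->
     s i j - s i j.+1 = s i.+1 j - s i.+1 j.+1) ->
  forall j, (j <= L)%N ->
  \sum_(0 <= k < j) (-1) ^+ k * s k j =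
    turning j - \sum_(0 <= i < j | odd i) (s 0%N i - s 0%N i.+1).
Proof.
move=> par; elim=> [|j IHj] lt_jL; first by rewrite /turning !big_nil subr0.
have -> : turning j.+1 = turning j + (-1) ^+ j * s j j.+1.
  by rewrite /turning big_nat_recr.
have -> : \sum_(0 <= i < j.+1 | odd i) (s 0%N i - s 0%N i.+1) =
    \sum_(0 <= i < j | odd i) (s 0%N i - s 0%N i.+1) +
    (if odd j then s 0%N j - s 0%N j.+1 else 0).
  by rewrite [LHS]big_mkcond big_nat_recr //= -big_mkcond.
have -> : turning j = \sum_(0 <= k < j) (-1) ^+ k * s k j +
    \sum_(0 <= i < j | odd i) (s 0%N i - s 0%N i.+1).
  by rewrite IHj ?subrK // ltnW.
rewrite [LHS]big_nat_recr //=.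
set F := fun k => s k j - s k j.+1.
have -> : \sum_(0 <= i < j) (-1) ^+ i * s i j.+1 =
    \sum_(0 <= i < j) (-1) ^+ i * s i j - \sum_(0 <= i < j) (-1) ^+ i * F i.
  by rewrite -sumrB; apply: eq_bigr => i _; rewrite /F; ring.
suff -> : \sum_(0 <= i < j) (-1) ^+ i * F i = if odd j then F 0%N else 0.
  by rewrite /F; ring.
have Fpar i : (i < j)%N -> odd i = odd j -> F i = F i.+1.
  by move=> lt_ij; apply: par; rewrite lt_ij.
case odd_j: (odd j).
  have -> : j = j./2.*2.+1 by lia.
  by apply: alternating_sum_odd => i lt_i; apply: Fpar; lia.
have -> : j = j./2.*2 by lia.
by apply: alternating_sum_even => i lt_i; apply: Fpar; lia.
Qed.

(* The case of a simple curve running from one end of a cylinder to the other. *)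
Lemma turning_through l :
  (forall i j, (i < j < l.*2)%N -> odd i = odd j ->
     s i j - s i j.+1 = s i.+1 j - s i.+1 j.+1) ->
  (forall j, (j < l)%N -> s 0%N j.*2.+1 = s 0%N j.*2.+2) ->
  (forall j, (j < l)%N -> s j.*2 l.*2 = s j.*2.+1 l.*2) ->
  turning l.*2 = 0.
Proof.
move=> par start stop; have := turning_partial par (leqnn _).
rewrite alternating_sum_even // big_nat_cond big1 ?subr0 // => i.
move=> /andP[lt_i odd_i]; have -> : i = i./2.*2.+1 by lia.
by apply/eqP; rewrite subr_eq0 start //; lia.
Qed.

(** As in Hopf's proof the start is an extreme point: all secants from it point to the right, which
    makes each of the two boundary sums equal to 1. *)
Lemma turning_closed_min l : (0 < l)%N ->
  (forall i j, (i < j < l.*2)%N -> odd i = odd j ->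
     s i j - s i j.+1 = s i.+1 j - s i.+1 j.+1) ->
  (forall j, (0 < j < l.*2)%N -> x 0%N < x j) -> x l.*2 = x 0%N ->
  turning l.*2 = 2.
Proof.
move=> l_gt0 par xmin xL; have := turning_partial par (leqnn _).
have s0 j : (0 < j < l.*2)%N -> s 0%N j = 1.
  by move=> /xmin lt_x; rewrite gtr0_sgz // subr_gt0.
have sL j : s j l.*2 = - s 0%N j by rewrite xL -sgzN opprB.
have -> : \sum_(0 <= k < l.*2) (-1) ^+ k * s k l.*2 = 1.
  transitivity (\sum_(0 <= k < l.-1.*2.+2) (-1) ^+ k * - s 0%N k).
    by rewrite -doubleS prednK //; apply: eq_bigr => i _; rewrite sL.
  rewrite big_nat_recr //= alternating_sum_odd ?subrr ?sgz0 => [|i lt_i].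
    by rewrite s0 ?exprS -?mul2n ?exprM ?sqrrN ?expr1n //; lia.
  by rewrite !s0 //; lia.
have -> : \sum_(0 <= i < l.*2 | odd i) (s 0%N i - s 0%N i.+1) = 1.
  transitivity (\sum_(0 <= i < l.-1.*2.+2 | odd i) (s 0%N i - s 0%N i.+1)).
    by rewrite -doubleS prednK.
  rewrite big_mkcond big_nat_recr //= -big_mkcond /= odd_double.
  rewrite big_nat_cond big1 => [|i /andP[lt_i odd_i]].
    rewrite -doubleS prednK // xL subrr sgz0 s0 //; lia.
  by rewrite !s0 ?subrr //; lia.
by move=> E; apply/eqP; rewrite -(subrK 1 (turning _)) -E.
Qed.

End Turning.

(* The Umlaufsatz: a simple closed curve in the plane has turning number 1 or
   -1, i.e. 2 or -2 half-turns. *)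
Lemma turning_closed (x : nat -> int) l : (0 < l)%N ->
  (forall i, x (i + l.*2)%N = x i) ->
  (forall i j, x i = x j -> i = j %[mod l.*2]) ->
  (forall i j, odd i = odd j -> i <> j %[mod l.*2] ->
     sgz (x j - x i) - sgz (x j.+1 - x i) =
     sgz (x j - x i.+1) - sgz (x j.+1 - x i.+1)) ->
  turning x l.*2 = 2 \/ turning x l.*2 = -2.
Proof.
move=> l_gt0 xper xinj xpar.
have L_gt0 : (0 < l.*2)%N by rewrite double_gt0.
pose i0 := [arg min_(i < Ordinal L_gt0) x i]%O : 'I_l.*2.
have xmin j : x i0 <= x j.
  have -> : x j = x (j %% l.*2)%N.
    rewrite {1}(divn_eq j l.*2) addnC; elim: (j %/ _)%N => [|k IHk].
      by rewrite addn0.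
    by rewrite mulSn addnCA addnC xper.
  rewrite /i0; case: arg_minP => // i _ /(_ (Ordinal (ltn_pmod j L_gt0))).
  exact.
have : turning (fun i => x (i0 + i)%N) l.*2 = 2.
  apply: turning_closed_min => //= [i j lt_ij odd_ij|j lt_j|]; last first.
  - by rewrite addn0 xper.
  - rewrite addn0 lt_neqAle xmin andbT; apply/eqP => /xinj.
    rewrite -{1}[i0 : nat]addn0 => /eqP; rewrite eqn_modDl mod0n modn_small //;
      lia.
  rewrite !addnS; apply: xpar; first by rewrite !oddD odd_ij.
  by move/eqP; rewrite eqn_modDl !modn_small //; lia.
pose F i := (-1) ^+ i * sgz (x i.+1 - x i).
have shift k : \sum_(0 <= i < l.*2) F (k + i)%N = \sum_(0 <= i < l.*2) F i.
  elim: k => [|k <-]; first by [].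
  rewrite -[in LHS](prednK L_gt0) -[in RHS](prednK L_gt0).
  rewrite big_nat_recr // [in RHS]big_nat_recl // addn0 addrC; congr (_ + _).
    by apply: eq_bigr => i _; rewrite addSnnS.
  rewrite /F addSnnS prednK // -addSn !xper exprD.
  by rewrite -mul2n exprM sqrrN !expr1n mulr1.
(* An odd shift exchanges the two sides of the axis and negates the sum; this is where the two signs
   come from. *)
have -> : turning (fun i => x (i0 + i)%N) l.*2 = (-1) ^+ i0 * turning x l.*2.
  rewrite /turning -/F -(shift i0) big_distrr /=.
  apply: eq_bigr => i _; rewrite /F addnS exprD !mulrA -exprD addnn.
  by rewrite -[in RHS]signr_odd odd_double mul1r.
by rewrite -signr_odd; case: odd => /= E; [right|left]; lia.
Qed.

(** * Arcs in the annulus *)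

Section Circle.

Variable n : nat.
Implicit Types (u v w t : point n) (a b : arc n).

Lemma ccw_spec u v :
  (ccw u v < 2 * n)%N /\ (ccw u v + u = v \/ ccw u v + u = v + 2 * n)%N.
Proof.
have lt_u := ltn_ord u; have lt_v := ltn_ord v; rewrite /ccw.
case: (leqP u v) => [le_uv|lt_vu].
  have -> : (v + (2 * n - u) = v - u + 2 * n)%N by lia.
  by rewrite modnDr modn_small; lia.
by rewrite modn_small; lia.
Qed.

Lemma in_under a v : (v \in under a) = (ccw a.1 v <= ccw a.1 a.2)%N.
Proof. by rewrite inE. Qed.

Lemma in_inner a v :
  (v \in inner a) = [&& v != a.1, v != a.2 & (ccw a.1 v <= ccw a.1 a.2)%N].
Proof. by rewrite !inE negb_or -andbA. Qed.

Lemma under_source a : a.1 \in under a.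
Proof.
by rewrite in_under; have := ccw_spec a.1 a.1; have := ltn_ord a.1; lia.
Qed.

Lemma under_target a : a.2 \in under a.
Proof. by rewrite in_under. Qed.

Lemma ccw_gt0 u v : u != v -> (0 < ccw u v)%N.
Proof.
move=> neq_uv; have : (u : nat) <> v by apply/eqP.
by have := ccw_spec u v; have := ltn_ord u; have := ltn_ord v; lia.
Qed.

Lemma disjoint_arcs_endpoints a b : disjoint_arcs a b ->
  [&& b.1 \notin under a & b.2 \notin under a] ||
  [&& a.1 \notin under b & a.2 \notin under b].
Proof.
have not_inner c v : v \in inner c -> (v != c.1) && (v != c.2).
  by rewrite in_inner => /and3P[-> ->].
case/or3P => [/disjointFl dis|/subsetP sub|/subsetP sub].
- by rewrite !dis ?under_source ?under_target.
- apply/orP; left; apply/andP; split; apply/negP => /sub /not_inner.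
    by rewrite eqxx.
  by rewrite eqxx andbF.
apply/orP; right; apply/andP; split; apply/negP => /sub /not_inner.
  by rewrite eqxx.
by rewrite eqxx andbF.
Qed.

(* The interval cut off by [b] lies in one of the two open intervals between the
   endpoints of [a]. *)
Lemma disjoint_arcs_outside a b :
  a.1 \notin under b -> a.2 \notin under b -> disjoint_arcs a b.
Proof.
case: a b => [a1 a2] [b1 b2]; rewrite !in_under /= => out1 out2.
case in_b1: (b1 \in under (a1, a2)).
  apply/or3P; apply: Or33; apply/subsetP => t; rewrite in_under in_inner /=.
  move: in_b1; rewrite in_under /= => in_b1 in_t.
  have [E|neq1] := eqVneq t a1; first by rewrite -E in_t in out1.
  have [E|neq2] := eqVneq t a2; first by rewrite -E in_t in out2.
  rewrite /=.
  move: (ccw_spec a1 b1) (ccw_spec a1 a2) (ccw_spec b1 t) (ccw_spec b1 b2).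
  move: (ccw_spec b1 a1) (ccw_spec b1 a2) (ccw_spec a1 t).
  move: (ltn_ord a1) (ltn_ord a2) (ltn_ord b1) (ltn_ord b2) (ltn_ord t).
  lia.
apply/or3P; apply: Or31; rewrite disjoint_sym disjoint_subset.
apply/subsetP => t; rewrite !inE /= => in_t; apply/negP => in_t'.
move: in_b1; rewrite in_under /= => in_b1.
move: (ccw_spec a1 b1) (ccw_spec a1 a2) (ccw_spec b1 t) (ccw_spec b1 b2).
move: (ccw_spec b1 a1) (ccw_spec b1 a2) (ccw_spec a1 t).
move: (ltn_ord a1) (ltn_ord a2) (ltn_ord b1) (ltn_ord b2) (ltn_ord t).
lia.
Qed.

Lemma disjoint_arcsC a b : disjoint_arcs a b = disjoint_arcs b a.
Proof. by rewrite /disjoint_arcs disjoint_sym; congr orb; rewrite orbC. Qed.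

(* [lifts x v]: the integer [x] projects to [v] in the universal cover of the
   boundary circle. *)
Definition lifts (x : int) v : Prop := exists k : int, x = v%:Z + k * (2 * n)%:Z.

Lemma lifts_ccw (x : int) u v : lifts x u -> lifts (x + (ccw u v)%:Z) v.
Proof.
case=> k ->; have [_ [E|E]] := ccw_spec u v.
  by exists k; rewrite -E PoszD; ring.
exists (k + 1); have := congr1 Posz E; rewrite !PoszD => E'.
have -> : (ccw u v)%:Z = v%:Z + (2 * n)%:Z - u%:Z by rewrite -E'; ring.
ring.
Qed.

Lemma lifts_ccwN (x : int) u v : lifts x v -> lifts (x - (ccw u v)%:Z) u.
Proof.
case=> k ->; have [_ [E|E]] := ccw_spec u v.
  by exists k; rewrite -E PoszD; ring.
exists (k - 1); have := congr1 Posz E; rewrite !PoszD => E'.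
have -> : v%:Z = (ccw u v)%:Z + u%:Z - (2 * n)%:Z by rewrite E'; ring.
ring.
Qed.

Lemma residue_unique (k : int) (r s c N : nat) : (r < N)%N -> (s < N)%N ->
  (c < N)%N /\ (c + r = s \/ c + r = s + N)%N ->
  0 <= s%:Z - r%:Z + k * N%:Z < N%:Z -> s%:Z - r%:Z + k * N%:Z = c%:Z.
Proof.
move=> lt_r lt_s c_spec bnd.
have [|[|[|]]] : k <= -1 \/ k = 0 \/ k = 1 \/ k >= 2 by lia.
- by nia.
- by move=> k_eq; move: bnd; rewrite k_eq; lia.
- by move=> k_eq; move: bnd; rewrite k_eq; lia.
by nia.
Qed.

Lemma lifts_sub (x z : int) u v : lifts x u -> lifts z v ->
  0 <= z - x < (2 * n)%:Z -> z - x = (ccw u v)%:Z.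
Proof.
case=> k -> [l ->].
have -> : v%:Z + l * (2 * n)%:Z - (u%:Z + k * (2 * n)%:Z) =
  v%:Z - u%:Z + (l - k) * (2 * n)%:Z by ring.
exact: residue_unique (ltn_ord u) (ltn_ord v) (ccw_spec u v).
Qed.

Lemma lifts_inj (x z : int) u v : lifts x u -> lifts z v -> x = z -> u = v.
Proof.
move=> lx lz E; apply/eqP/negPn/negP => /ccw_gt0.
have := lifts_sub lx lz; rewrite E subrr => H.
by have := ltn_ord u; lia.
Qed.

Lemma sgz_outside (x y z : int) : ~~ (x <= z <= y) -> x <= y ->
  sgz (z - x) = sgz (z - y).
Proof. by move=> out le_xy; do 2 case: sgzP; lia. Qed.

(** No translate of a point outside [under a] falls between the two ends of a lift of [a], so both
    ends are seen from it in the same direction. *)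
Lemma sgz_lift_outside a (x z : int) t : lifts x a.1 -> lifts z t ->
  t \notin under a -> sgz (z - x) = sgz (z - (x + (ccw a.1 a.2)%:Z)).
Proof.
move=> lx lz; rewrite in_under => out; apply: sgz_outside; last by lia.
have := lifts_sub lx lz; have := ccw_spec a.1 a.2; lia.
Qed.

Lemma sgz_lift_outsideN a (x z : int) t : lifts x a.2 -> lifts z t ->
  t \notin under a -> sgz (z - x) = sgz (z - (x - (ccw a.1 a.2)%:Z)).
Proof.
move=> lx lz out; have := sgz_lift_outside (lifts_ccwN a.1 lx) lz out.
by rewrite subrK.
Qed.

(** On the circle cut open at [t] a swept angle is a difference of coordinates, corrected by a full
    turn for an arc that passes over the cut. *)
Lemma ccw_seen_from t a : t != a.1 -> t != a.2 ->
  (ccw a.1 a.2)%:Z =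
    (ccw t a.2)%:Z - (ccw t a.1)%:Z + (2 * n)%:Z * (t \in under a)%:R.
Proof.
move=> neq1 neq2; rewrite in_under.
have := ccw_gt0 neq1; have := ccw_gt0 neq2.
move: (ccw_spec a.1 a.2) (ccw_spec t a.2) (ccw_spec t a.1) (ccw_spec a.1 t).
move: (ltn_ord a.1) (ltn_ord a.2) (ltn_ord t).
by case: leqP; lia.
Qed.

End Circle.

(** * Noncrossing connections and their involutions *)

Section Noncrossing.

Variable n : nat.
Implicit Types (u v w t : point n) (a b : arc n) (A : {set arc n}).

(** The clauses of [Mb] other than the cardinality, so that connections with four free ends are
    covered too. *)
Definition noncrossing A : bool :=
  [&& [forall a in A, a.1 != a.2],
      [forall a in A, [forall b in A, (a != b) ==> disjoint_arcs a b]]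
    & [forall a in A, [disjoint through A & under a]]].

Definition endpoint a v : bool := (v == a.1) || (v == a.2).

Lemma Mb_noncrossing A : (A \in Mb n) = (#|A| == n.-1) && noncrossing A.
Proof. by rewrite inE. Qed.

Lemma throughP A v :
  reflect (forall a, a \in A -> ~~ endpoint a v) (v \in through A).
Proof.
rewrite inE; apply: (iffP forall_inP) => H a /H; first by rewrite negb_or.
by rewrite negb_or.
Qed.

Lemma notin_throughP A v :
  reflect (exists2 a, a \in A & endpoint a v) (v \notin through A).
Proof.
apply: (iffP idP) => [|[a aA end_a]]; last first.
  by apply/negP => /throughP/(_ a aA); rewrite end_a.
rewrite inE negb_forall => /existsP[a]; rewrite negb_imply => /andP[aA E].
by exists a => //; rewrite /endpoint; move: E; rewrite negb_and !negbK.
Qed.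

Section Fixed.

Variable A : {set arc n}.
Hypothesis A_nc : noncrossing A.

Lemma arc_neq a : a \in A -> a.1 != a.2.
Proof. by case/and3P: A_nc => /forall_inP H _ _; apply: H. Qed.

Lemma arc_disjoint a b : a \in A -> b \in A -> a != b -> disjoint_arcs a b.
Proof.
case/and3P: A_nc => _ /forall_inP H _ /H/forall_inP H' /H'/implyP.
exact.
Qed.

Lemma through_outside a v : a \in A -> v \in through A -> v \notin under a.
Proof.
case/and3P: A_nc => _ _ /forall_inP H /H dis v_thr.
by rewrite (disjointFr dis).
Qed.

Lemma arc_unique a b v : a \in A -> b \in A -> endpoint a v -> endpoint b v ->
  a = b.
Proof.
move=> aA bA end_a end_b; apply/eqP/negPn/negP => neq_ab.
have end_under c : endpoint c v -> v \in under c.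
  by case/orP => /eqP ->; rewrite ?under_source ?under_target.
case/orP: (disjoint_arcs_endpoints (arc_disjoint aA bA neq_ab)) => /andP[].
  by case/orP: (end_b) => /eqP <-; rewrite end_under.
by case/orP: (end_a) => /eqP <-; rewrite end_under.
Qed.

Lemma sum_endpoints (F : point n -> int) :
  \sum_(v | v \notin through A) F v = \sum_(a in A) (F a.1 + F a.2).
Proof.
transitivity (\sum_v \sum_(a in A) F v *+ endpoint a v).
  rewrite big_mkcond; apply: eq_bigr => v _ /=.
  case: (notin_throughP A v) => [[a aA end_a]|no_a].
    rewrite (bigD1 a) //= end_a big1 ?addr0 // => b /andP[bA neq_ba].
    case end_b: (endpoint b v) => //.
    by rewrite (arc_unique bA aA end_b end_a) eqxx in neq_ba.
  rewrite big1 // => a aA; case end_a: (endpoint a v) => //.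
  by case: no_a; exists a.
rewrite exchange_big /=; apply: eq_bigr => a aA.
rewrite (bigD1 a.1) //= (bigD1 a.2) /=; last by rewrite eq_sym arc_neq.
rewrite big1 => [|v /andP[neq1 neq2]]; last first.
  by rewrite /endpoint (negbTE neq1) (negbTE neq2).
by rewrite /endpoint !eqxx orbT addr0.
Qed.

Lemma card_through : (#|through A| + 2 * #|A|)%N = (2 * n)%N.
Proof.
have := sum_endpoints (fun=> 1).
have -> : \sum_(v | v \notin through A) 1 = #|~: through A|%:R :> int.
  by rewrite -sum1_card natr_sum; apply: eq_bigl => v; rewrite [RHS]inE.
rewrite sumr_const -mulr2n -mulrnA => /eqP; rewrite eqr_nat => /eqP E.
by rewrite -E cardsC card_ord.
Qed.

End Fixed.

Section Mates.

Variable A : {set arc n}.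
Hypotheses (n_gt0 : (0 < n)%N) (A_Mb : A \in Mb n).

Lemma Mb_nc : noncrossing A.
Proof. by move: A_Mb; rewrite Mb_noncrossing => /andP[]. Qed.
Local Notation A_nc := Mb_nc.

Lemma Mb_card : #|A| = n.-1.
Proof. by move: A_Mb; rewrite Mb_noncrossing => /andP[/eqP]. Qed.

Lemma card_through_Mb : #|through A| = 2.
Proof. by have := card_through A_nc; rewrite Mb_card; lia. Qed.

Lemma through_pair u v w : u \in through A -> v \in through A ->
  w \in through A -> u != v -> u != w -> v = w.
Proof.
move=> uT vT wT neq_uv neq_uw; apply/eqP/negPn/negP => neq_vw.
have /subset_leq_card : [set u; v; w] \subset through A.
  by apply/subsetP => x /setUP[/setUP[]|] /set1P ->.
by rewrite card_through_Mb -setUA cardsU1 cards2 neq_vw in_set2 negb_or neq_uv neq_uw.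
Qed.

Lemma joined_functional u v w : joined A u v -> joined A u w -> v = w.
Proof.
have thrN a x : a \in A -> endpoint a x -> x \in through A -> False.
  by move=> aA end_a /throughP/(_ a aA); rewrite end_a.
have ends x y : endpoint (x, y) x /\ endpoint (x, y) y.
  by rewrite /endpoint /= !eqxx orbT.
case/or3P => [uv|vu|/and3P[neq_uv uT vT]] /or3P[uw|wu|/and3P[neq_uw uT' wT]].
- by have [] := arc_unique A_nc uv uw (ends _ _).1 (ends _ _).1.
- have [E1 E2] := arc_unique A_nc uv wu (ends _ _).1 (ends _ _).2.
  by have /= := arc_neq A_nc uv; rewrite E2 eqxx.
- by case: (thrN _ _ uv (ends _ _).1 uT').
- have [E1 E2] := arc_unique A_nc vu uw (ends _ _).2 (ends _ _).1.
  by have /= := arc_neq A_nc vu; rewrite E1 eqxx.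
- by have [] := arc_unique A_nc vu wu (ends _ _).2 (ends _ _).2.
- by case: (thrN _ _ vu (ends _ _).2 uT').
- by case: (thrN _ _ uw (ends _ _).1 uT).
- by case: (thrN _ _ wu (ends _ _).2 uT).
exact: through_pair uT vT wT neq_uv neq_uw.
Qed.

Lemma joined_total u : exists v, joined A u v.
Proof.
case: (boolP (u \in through A)) => [uT|/notin_throughP[[a1 a2] aA]].
  have : (0 < #|through A :\ u|)%N.
    by have := cardsD1 u (through A); rewrite uT card_through_Mb add1n => -[<-].
  case/card_gt0P => v /setD1P[neq_vu vT].
  by exists v; apply/or3P/Or33; rewrite eq_sym neq_vu uT.
by case/orP => /eqP /= ->; [exists a2 | exists a1]; rewrite /joined aA ?orbT.
Qed.

Lemma joined_mate u v : joined A u v = (mate A u == v).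
Proof.
rewrite /mate; case: pickP => [w uw /=|none]; last first.
  by have [w] := joined_total u; rewrite none.
by apply/idP/eqP => [/(joined_functional uw)|<-].
Qed.

Lemma mate_joined u : joined A u (mate A u).
Proof. by rewrite joined_mate. Qed.

Lemma joined_sym u v : joined A u v = joined A v u.
Proof.
by rewrite /joined orbCA eq_sym [(u \in _) && _]andbC.
Qed.

Lemma mateK : involutive (mate A).
Proof. by move=> u; apply/eqP; rewrite -joined_mate joined_sym mate_joined. Qed.

Lemma mate_fix u : mate A u != u.
Proof.
rewrite -joined_mate /joined eqxx orbF orbb.
by apply/negP => /(arc_neq A_nc); rewrite eqxx.
Qed.

Lemma mate_source a : a \in A -> mate A a.1 = a.2.
Proof. by case: a => u v aA; apply/eqP; rewrite -joined_mate /joined aA. Qed.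

Lemma mate_target a : a \in A -> mate A a.2 = a.1.
Proof. by move=> aA; rewrite -(mate_source aA) mateK. Qed.

Lemma mate_through u : (mate A u \in through A) = (u \in through A).
Proof.
wlog suff: u / u \in through A -> mate A u \in through A.
  by move=> W; apply/idP/idP => /W //; rewrite mateK.
move=> uT; have /or3P[uv|vu|/and3P[]//] := mate_joined u.
  by have /throughP/(_ _ uv) := uT; rewrite /endpoint eqxx.
by have /throughP/(_ _ vu) := uT; rewrite /endpoint eqxx orbT.
Qed.

Lemma through_mate u v : u \in through A -> v \in through A ->
  v = u \/ v = mate A u.
Proof.
move=> uT vT; have [->|neq] := eqVneq v u; [by left | right].
by apply/esym/eqP; rewrite -joined_mate /joined eq_sym neq uT vT !orbT.
Qed.

Variant mate_spec u : point n -> bool -> bool -> bool -> Type :=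
  | MateSource v of (u, v) \in A : mate_spec u v true false false
  | MateTarget v of (v, u) \in A : mate_spec u v false true false
  | MateThrough v of u \in through A & v \in through A :
      mate_spec u v false false true.

Lemma mateP u : mate_spec u (mate A u) ((u, mate A u) \in A)
  ((mate A u, u) \in A) (u \in through A).
Proof.
have E1 v : endpoint (u, v) u by rewrite /endpoint eqxx.
have E2 v : endpoint (v, u) u by rewrite /endpoint eqxx orbT.
case uv: ((u, mate A u) \in A).
  have -> : (u \in through A) = false.
    by apply/negbTE/notin_throughP; exists (u, mate A u).
  have -> : (mate A u, u) \in A = false.
    apply/negP => vu; have [E _] := arc_unique A_nc uv vu (E1 _) (E2 _).
    by have := mate_fix u; rewrite -E eqxx.
  exact: MateSource.
case vu: ((mate A u, u) \in A).
  have -> : (u \in through A) = false.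
    by apply/negbTE/notin_throughP; exists (mate A u, u).
  exact: MateTarget.
have := mate_joined u; rewrite /joined uv vu /= => /and3P[_ uT vT].
by rewrite uT; apply: MateThrough.
Qed.

End Mates.

End Noncrossing.

(** * Angles swept by arcs, and their signs in the universal cover *)

Section Sweeps.

Variables (n : nat) (A : {set arc n}).
Hypotheses (n_gt0 : (0 < n)%N) (A_Mb : A \in Mb n).
Implicit Types (u v w t : point n) (x z : int).
Local Notation m := (mate A).

Definition orientation u : int := ((u, m u) \in A)%:R - ((m u, u) \in A)%:R.

(** Signed: 1 for an arc traversed counterclockwise over [t], -1 for one traversed clockwise. *)
Definition passes u t : int :=
  if (u, m u) \in A then (t \in under (u, m u))%:R
  else if (m u, u) \in A then - (t \in under (m u, u))%:R
  else 0.

Lemma orientation_mate u : orientation (m u) = - orientation u.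
Proof. by rewrite /orientation (mateK n_gt0 A_Mb) opprB. Qed.

Lemma lifts_sweep x u : u \notin through A -> lifts x u ->
  lifts (x + sweep A u) (m u).
Proof.
move=> uT lx; rewrite /sweep; move: uT.
case: (mateP n_gt0 A_Mb u) => [v _|v _|v _ _] // _; first exact: lifts_ccw.
exact: lifts_ccwN.
Qed.

Lemma sgz_sweep u : sgz (sweep A u) = orientation u.
Proof.
have A_nc := Mb_nc A_Mb.
rewrite /sweep /orientation; case: (mateP n_gt0 A_Mb u) => [v|v|v _ _].
- by move/(arc_neq A_nc)/ccw_gt0 => ?; rewrite gtr0_sgz // subr0.
- by move/(arc_neq A_nc)/ccw_gt0 => ?; rewrite sgzN gtr0_sgz // sub0r.
by rewrite sgz0 subrr.
Qed.

Lemma sgz_sweep_outside u t x z : u \notin through A -> lifts x u -> lifts z t ->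
  (forall a, a \in A -> endpoint a u -> t \notin under a) ->
  sgz (z - x) = sgz (z - (x + sweep A u)).
Proof.
move=> uT lx lz out; rewrite /sweep; move: uT.
case: (mateP n_gt0 A_Mb u) => [v uv|v vu|v _ _] // _.
  apply: (@sgz_lift_outside _ (u, v) _ _ t) => //; apply: out => //.
  by rewrite /endpoint eqxx.
apply: (@sgz_lift_outsideN _ (v, u) _ _ t) => //; apply: out => //.
by rewrite /endpoint eqxx orbT.
Qed.

Lemma sgz_sweep_through u t x z : u \notin through A -> t \in through A ->
  lifts x u -> lifts z t -> sgz (z - x) = sgz (z - (x + sweep A u)).
Proof.
move=> uT tT lx lz; apply: sgz_sweep_outside uT lx lz _ => a aA _.
exact (through_outside (Mb_nc A_Mb) aA tT).
Qed.

Lemma arcs_at u w a b : a \in A -> b \in A -> endpoint a u -> endpoint b w ->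
  w != u -> w != m u -> a != b.
Proof.
move=> aA bA end_a end_b neq1 neq2; apply/eqP => E; move: end_b; rewrite -E.
by case/orP: end_a neq1 neq2 => /eqP ->;
  rewrite /endpoint ?(mate_source n_gt0 A_Mb aA) ?(mate_target n_gt0 A_Mb aA);
  do 2 move=> /negbTE ->.
Qed.

Lemma endpoint_mate a u : a \in A -> endpoint a (m u) = endpoint a u.
Proof.
move=> aA; rewrite /endpoint orbC -{1}(mate_source n_gt0 A_Mb aA).
by rewrite -{2}(mate_target n_gt0 A_Mb aA) !(inj_eq (inv_inj (mateK n_gt0 A_Mb))).
Qed.

(** This is the hypothesis of Hopf's argument. One of the two arcs has both ends outside the other,
    and from each of them the two ends of that other arc are seen in the same direction. *)
Lemma sgz_sweep_disjoint u w x z : u \notin through A -> w \notin through A ->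
  w != u -> w != m u -> lifts x u -> lifts z w ->
  sgz (z - x) - sgz (z + sweep A w - x) =
  sgz (z - (x + sweep A u)) - sgz (z + sweep A w - (x + sweep A u)).
Proof.
move=> uT wT neq1 neq2 lx lz.
have [a aA end_a] := notin_throughP _ _ uT.
have [b bA end_b] := notin_throughP _ _ wT.
have neq_ab := arcs_at aA bA end_a end_b neq1 neq2.
have A_nc := Mb_nc A_Mb.
have ends c v : endpoint c v -> forall P : pred (point n), P c.1 -> P c.2 -> P v.
  by case/orP => /eqP ->.
have lx' := lifts_sweep uT lx; have lz' := lifts_sweep wT lz.
case/orP: (disjoint_arcs_endpoints (arc_disjoint A_nc aA bA neq_ab)) => /andP[o1 o2].
  have out c : c \in A -> endpoint c u -> forall v, endpoint b v -> v \notin under c.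
    move=> cA end_c v end_v; rewrite (arc_unique A_nc cA aA end_c end_a).
    exact: (ends _ _ end_v (fun v => v \notin under a)).
  rewrite (sgz_sweep_outside uT lx lz); last by move=> c cA /(out _ cA); apply.
  rewrite (sgz_sweep_outside uT lx lz') // => c cA /(out _ cA); apply.
  by rewrite endpoint_mate.
have out c : c \in A -> endpoint c w -> forall v, endpoint a v -> v \notin under c.
  move=> cA end_c v end_v; rewrite (arc_unique A_nc cA bA end_c end_b).
  exact: (ends _ _ end_v (fun v => v \notin under b)).
have flip (p q : int) : sgz (p - q) = - sgz (q - p) by rewrite -sgzN opprB.
rewrite !(flip z) !(flip (z + _)).
rewrite -(sgz_sweep_outside wT lz lx); last by move=> c cA /(out _ cA); apply.
rewrite -(sgz_sweep_outside wT lz lx') ?subrr // => c cA /(out _ cA); apply.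
by rewrite endpoint_mate.
Qed.

Lemma sweep_passes u t : t != u -> t != m u ->
  sweep A u = if u \in through A then 0 else
    (ccw t (m u))%:Z - (ccw t u)%:Z + (2 * n)%:Z * passes u t.
Proof.
rewrite /sweep /passes.
case: (mateP n_gt0 A_Mb u) => [v _|v _|v _ _] // neq1 neq2.
  exact: (@ccw_seen_from _ t (u, v)).
by rewrite (@ccw_seen_from _ t (v, u)) //=; ring.
Qed.

Lemma passes_mate u t : t != u -> t != m u -> passes u (m t) = passes u t.
Proof.
move=> neq1 neq2; have A_nc := Mb_nc A_Mb.
have same a : a \in A -> endpoint a u -> (m t \in under a) = (t \in under a).
  move=> aA end_a; case: (boolP (t \in through A)) => [tT|tT].
    rewrite !(negbTE (through_outside A_nc aA _)) //.
    by rewrite (mate_through n_gt0 A_Mb).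
  have [b bA end_b] := notin_throughP _ _ tT.
  have neq_ab := arcs_at aA bA end_a end_b neq1 neq2.
  have ends P : P b.1 = P b.2 :> bool -> P (m t) = P t.
    case/orP: end_b => /eqP ->.
      by rewrite (mate_source n_gt0 A_Mb bA).
    by rewrite (mate_target n_gt0 A_Mb bA).
  apply: (ends (fun v => v \in under a)).
  have := arc_disjoint A_nc aA bA neq_ab.
  case/or3P => [/disjointFl dis|/subsetP sub|/subsetP sub].
  - by rewrite !dis ?under_source ?under_target.
  - have out c : endpoint b c -> c \in under a = false.
      by move=> end_c; apply/negP => /sub; rewrite in_inner andbA -negb_or;
        rewrite -/(endpoint b c) end_c.
    by rewrite !out // /endpoint eqxx ?orbT.
  have inn c : c \in under b -> c \in under a.
    by move/sub; rewrite in_inner in_under => /and3P[].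
  by rewrite !inn ?under_source ?under_target.
rewrite /passes; case: (mateP n_gt0 A_Mb u) same => [v uv|v vu|v _ _] // same.
  by rewrite same // /endpoint eqxx.
by rewrite same // /endpoint eqxx orbT.
Qed.

Lemma passes_through u t : t \in through A -> passes u t = 0.
Proof.
move=> tT; have out a : a \in A -> (t \in under a) = false.
  by move=> aA; apply: negbTE (through_outside (Mb_nc A_Mb) aA tT).
rewrite /passes; case: (mateP n_gt0 A_Mb u) => [v uv|v vu|v _ _] //;
by rewrite out ?oppr0.
Qed.

End Sweeps.

(** * Curves on the Klein bottle *)

Section Unrolling.

Variables (n : nat) (A B : {set arc n}).
Hypotheses (n_gt0 : (0 < n)%N) (A_Mb : A \in Mb n) (B_Mb : B \in Mb n).
Variable u : point n.

Local Notation f := (mate A).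
Local Notation g := (mate B).
Local Notation r := (g \o f).
Local Notation W := (walk f g u).
Local Notation side i := (if odd i then B else A).

Let fK := mateK n_gt0 A_Mb.
Let gK := mateK n_gt0 B_Mb.

(** The lift of the walk to the universal cover, with the arcs of [A] (even steps) above the axis
    and those of [B] below. The dummy sweep 0 of a through arc makes it a lift only before the first
    such arc, hence [through_free]. *)
Definition position (i : nat) : int :=
  u%:Z + \sum_(0 <= k < i) sweep (side k) (W k).

Lemma positionS i : position i.+1 = position i + sweep (side i) (W i).
Proof. by rewrite /position big_nat_recr //= addrA. Qed.

Lemma side_Mb i : side i \in Mb n. Proof. by case: odd. Qed.

Lemma walkS_side i : W i.+1 = mate (side i) (W i).
Proof. by rewrite walkS; case: odd. Qed.

Definition through_free (i : nat) : bool := W i \notin through (side i).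

Lemma lifts_position i : (forall k, (k < i)%N -> through_free k) -> lifts (position i) (W i).
Proof.
elim: i => [|i IHi] all_free.
  by exists 0; rewrite /position big_nil mul0r.
rewrite positionS walkS_side.
apply: (lifts_sweep n_gt0 (side_Mb i)); first exact: all_free.
by apply: IHi => k lt_ki; apply: all_free; apply: ltnW.
Qed.

Lemma position_disjoint i j :
  (forall k, (k <= maxn i j)%N -> through_free k) -> odd i = odd j ->
  W j <> W i -> W j <> W i.+1 ->
  sgz (position j - position i) - sgz (position j.+1 - position i) =
  sgz (position j - position i.+1) - sgz (position j.+1 - position i.+1).
Proof.
move=> all_free odd_ij neq1 neq2.
rewrite !positionS -odd_ij; apply: (sgz_sweep_disjoint n_gt0 (side_Mb i)).
- by apply: all_free; apply: leq_maxl.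
- by rewrite odd_ij; apply: all_free; apply: leq_maxr.
- exact/eqP.
- by apply/eqP; rewrite -walkS_side.
- by apply: lifts_position => k lt_k; apply: all_free; rewrite leq_max (ltnW lt_k).
by apply: lifts_position => k lt_k; apply: all_free; rewrite leq_max (ltnW lt_k) orbT.
Qed.

(** Away from the arcs through the crosscaps this is 2 or -2 where the curve turns back in angle and
    0 where it goes on; it joins the half-turns before and after [v]. *)
Definition tilt (v : point n) : int := orientation A v + orientation B v.

Lemma sgz_step i :
  sgz (position i.+1 - position i) = orientation (side i) (W i).
Proof. by rewrite positionS addrAC subrr add0r (sgz_sweep n_gt0 (side_Mb i)). Qed.

Lemma turning_position l :
  turning position l.*2 = - \sum_(0 <= i < l) tilt (W i.*2.+1).
Proof.
elim: l => [|l IHl]; first by rewrite /turning !big_nil oppr0.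
rewrite doubleS /turning big_nat_recr //= big_nat_recr //= -/(turning _ _) IHl.
rewrite [in RHS]big_nat_recr //= !sgz_step /tilt walkS_side /= odd_double /=.
rewrite (orientation_mate n_gt0 A_Mb) exprS -signr_odd odd_double; ring.
Qed.

Lemma tilt_through l : (l.*2 < walk_length f g u)%N ->
  u \in through B -> W l.*2 \in through A ->
  (forall i, (i < l.*2)%N -> through_free i) ->
  \sum_(0 <= i < l) tilt (W i.*2.+1) = 0.
Proof.
move=> lt_lL uT lT all_free; apply/eqP; rewrite -oppr_eq0 -turning_position.
have lift i : (i <= l.*2)%N -> lifts (position i) (W i).
  by move=> le_i; apply: lifts_position => k lt_k; apply: all_free; apply: leq_trans le_i.
have inj i j : (i <= l.*2)%N -> (j <= l.*2)%N -> W i = W j -> i = j.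
  by move=> ? ?; apply: walk_inj => //; try exact: mate_fix; apply: leq_ltn_trans lt_lL.
apply/eqP; apply: turning_through => [i j /andP[lt_ij lt_j] odd_ij|j lt_j|j lt_j].
- apply: position_disjoint => // [k||].
  + by rewrite leq_max => le_k; apply: all_free; lia.
  + by move/inj; lia.
  by move/inj; lia.
- have flip (p q : int) : sgz (p - q) = - sgz (q - p) by rewrite -sgzN opprB.
  rewrite 2!(flip (position _) (position 0)) [in RHS]positionS; congr (- _).
  have odd_j : odd j.*2.+1 by rewrite /= odd_double.
  have fr := all_free j.*2.+1; rewrite /through_free odd_j in fr; rewrite odd_j.
  apply: (sgz_sweep_through n_gt0 B_Mb _ uT); first by apply: fr; lia.
    by apply: lift; lia.
  by apply: (lift 0%N); lia.
have ev_j : odd j.*2 = false by rewrite odd_double.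
have fr := all_free j.*2; rewrite /through_free ev_j in fr; rewrite positionS ev_j.
apply: (sgz_sweep_through n_gt0 A_Mb _ lT); first by apply: fr; lia.
  by apply: lift; lia.
exact: lift.
Qed.

Lemma winding_walk :
  winding A B u = \sum_(0 <= k < walk_length f g u) sweep (side k) (W k).
Proof.
rewrite /winding /orbit (big_nth u) size_traject /walk_length.
rewrite -/(order r u); set m := order r u.
have -> : \sum_(0 <= i < m) (sweep A (nth u (traject r u m) i) +
      sweep B (mate A (nth u (traject r u m) i))) =
    \sum_(0 <= i < m) (sweep A (iter i r u) + sweep B (f (iter i r u))).
  by apply: eq_big_nat => i /andP[_ lt_i]; rewrite nth_traject.
elim: m => [|m IHm]; first by rewrite !big_nil.
rewrite doubleS big_nat_recr //= IHm [RHS]big_nat_recr //= big_nat_recr //=.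
by rewrite odd_double /= walkS odd_double walk_double addrA.
Qed.

Lemma turning_loop : (forall i, through_free i) -> winding A B u = 0 ->
  turning position (walk_length f g u) = 2 \/
  turning position (walk_length f g u) = -2.
Proof.
move=> all_free wind0; pose L := walk_length f g u.
have odd_L i : odd (i + L) = odd i by rewrite oddD odd_double addbF.
(* Winding number 0 means that the lift closes up, so that the Umlaufsatz for plane curves
   applies. *)
have per i : position (i + L) = position i.
  elim: i => [|i IHi]; last first.
    by rewrite addSn !positionS IHi odd_L walk_periodic.
  by rewrite /position add0n -winding_walk wind0 big_nil.
have lift i : lifts (position i) (W i) by apply: lifts_position.
have inj i j : W i = W j -> i = j %[mod L].
  rewrite -(walk_mod fK gK u i) -(walk_mod fK gK u j).
  by apply: walk_inj => //; try exact: mate_fix; rewrite ltn_pmod ?walk_length_gt0.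
apply: turning_closed; first exact: order_gt0.
- exact: per.
- by move=> i j E; apply: inj; apply: lifts_inj E.
move=> i j odd_ij neq_ij; apply: position_disjoint => // /inj E.
  by case: neq_ij.
have := congr1 odd E; rewrite !odd_mod ?odd_double //= odd_ij.
by case: odd.
Qed.

End Unrolling.

(** * The two directions of a curve, its turning number and its winding number *)

Section Curves.

Variables (n : nat) (A B : {set arc n}).
Hypotheses (n_gt0 : (0 < n)%N) (A_Mb : A \in Mb n) (B_Mb : B \in Mb n).
Implicit Types (u v w t p q : point n).

Local Notation f := (mate A).
Local Notation g := (mate B).
Local Notation r := (g \o f).
Local Notation linked := (connect (glued f g)).
Local Notation E := (tilt A B).

Let fK := mateK n_gt0 A_Mb.
Let gK := mateK n_gt0 B_Mb.
Let rI : injective r := comp_involutive_inj fK gK.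
Let f_fix := mate_fix n_gt0 A_Mb.
Let g_fix := mate_fix n_gt0 B_Mb.

Lemma in_curve u v : (v \in curve A B u) = linked u v.
Proof.
rewrite inE; apply: eq_connect => s t /=.
by rewrite (joined_mate n_gt0 A_Mb) (joined_mate n_gt0 B_Mb).
Qed.

Lemma linked_sym u v : linked u v = linked v u.
Proof. exact: (connect_glued_sym fK gK). Qed.

Lemma linked_mateA u v : linked u (f v) = linked u v.
Proof.
have step w : linked w (f w) by apply: connect1; rewrite /glued /= eqxx.
apply/idP/idP => uv; apply: connect_trans uv _; last exact: step.
by rewrite linked_sym.
Qed.

Lemma linked_mateB u v : linked u (g v) = linked u v.
Proof.
have step w : linked w (g w) by apply: connect1; rewrite /glued /= eqxx orbT.
apply/idP/idP => uv; apply: connect_trans uv _; last exact: step.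
by rewrite linked_sym.
Qed.

Lemma curve_eq u v : (curve A B u == curve A B v) = linked u v.
Proof.
apply/eqP/idP => [E|uv]; first by rewrite -in_curve E in_curve connect0.
apply/setP => w; rewrite !in_curve.
exact: (same_connect (connect_glued_sym fK gK)).
Qed.

Lemma fconnect_linked u v : fconnect r u v -> linked u v.
Proof.
move/iter_findex <-; elim: findex => [|i IHi] /=; first exact: connect0.
by rewrite linked_mateB linked_mateA.
Qed.

Lemma fconnect_mateA u w : fconnect r (f u) (f w) = fconnect r u w.
Proof.
wlog suff: u w / fconnect r u w -> fconnect r (f u) (f w).
  by move=> H; apply/idP/idP => /H //; rewrite !fK.
move/iter_findex <-; rewrite fconnect_sym // iter_reflect.
by rewrite -{2}(iter_unreflect gK fK (findex r u w) (f u)) fconnect_iter.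
Qed.

(** The points of a curve, taken alternately, form two orbits of [g \o f], one for each direction;
    [mate A] exchanges them. *)
Lemma linkedE u v : linked u v = fconnect r u v || fconnect r (f u) v.
Proof.
apply/idP/orP => [/(connect_gluedP fK gK)[i _ ->]|[]].
- rewrite /walk; case: odd; [right | left]; last exact: fconnect_iter.
  by rewrite fconnect_mateA fconnect_iter.
- exact: fconnect_linked.
by move/fconnect_linked; rewrite !(linked_sym _ v) linked_mateA.
Qed.

(** For a curve disjoint from the through arcs and of winding number 0, this is the number of
    half-turns of the walk from [u]. *)
Definition chi u : int := \sum_(w | fconnect r u w) E w.

Lemma chi_fconnect u v : fconnect r u v -> chi u = chi v.
Proof.
by move=> uv; apply: eq_bigl => w; apply: same_connect uv _; apply: fconnect_sym.
Qed.

Lemma sum_tilt_mateA u : \sum_(w | fconnect r u w) E (f w) = - chi u.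
Proof.
rewrite /chi -sumrN /tilt.
under eq_bigr do rewrite (orientation_mate n_gt0 A_Mb).
under [RHS]eq_bigr do rewrite opprD.
rewrite [LHS]big_split [RHS]big_split /=; congr (_ + _); rewrite [RHS](reindex_inj rI) /=.
apply: eq_big => [w|w _]; first by rewrite -same_fconnect1_r.
by rewrite (orientation_mate n_gt0 B_Mb) opprK.
Qed.

Lemma chi_mateA u : chi (f u) = - chi u.
Proof.
rewrite -sum_tilt_mateA /chi (reindex_inj (inv_inj fK)) /=.
by apply: eq_bigl => w; rewrite fconnect_mateA.
Qed.

Lemma chi_mateB u : chi (g u) = - chi u.
Proof.
rewrite -chi_mateA; apply/esym/chi_fconnect.
by have := fconnect1 r (f u); rewrite /= fK.
Qed.

Lemma sum_orbit (F : point n -> int) u :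
  \sum_(0 <= i < order r u) F (iter i r u) = \sum_(w | fconnect r u w) F w.
Proof.
transitivity (\sum_(w <- orbit r u) F w).
  rewrite /orbit [RHS](big_nth u) size_traject.
  by apply: eq_big_nat => i /andP[_ lt_i]; rewrite nth_traject.
rewrite big_uniq ?orbit_uniq //; apply: eq_bigl => w.
by rewrite -fconnect_orbit.
Qed.

Lemma chi_loop u :
  (forall v, linked u v -> (v \notin through A) && (v \notin through B)) ->
  winding A B u = 0 -> chi u = 2 \/ chi u = -2.
Proof.
move=> closed wind0; have all_free i : through_free A B u i.
  rewrite /through_free; have /andP[] := closed _ (connect_walk f g u i).
  by case: odd.
have := turning_loop n_gt0 A_Mb B_Mb all_free wind0.
rewrite turning_position //; under eq_bigr do rewrite /walk /= odd_double /= uphalf_double.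
by rewrite (sum_orbit (fun w => E (f w))) sum_tilt_mateA opprK.
Qed.

(* Signed number of passages over [t] of the arcs of [A'] on the curve through
   [u].  For [A' = A] it is invariant under [t |-> mate A t], and it vanishes at
   the ends of the arc of [A] through the crosscap; likewise for [B].  The sum of
   both numbers is the winding number up to a constant factor, so each of them is
   constant along any curve disjoint from the one through [u]. *)
Definition passings (A' : {set arc n}) (h : point n -> point n) u t : int :=
  \sum_(v | fconnect r u v) passes A' (h v) t.

(** On the circle cut open at [t] the angles telescope around the closed curve, and only the full
    turns made over [t] remain. *)
Lemma winding_passings u t : ~~ linked u t ->
  (forall v, linked u v -> (v \notin through A) && (v \notin through B)) ->
  winding A B u = (2 * n)%:Z * (passings A id u t + passings B f u t).
Proof.
move=> ut closed; have neq v : linked u v -> t != v.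
  by move=> uv; apply: contraNneq ut => ->.
rewrite /winding big_uniq ?orbit_uniq //=.
under eq_bigl do rewrite -fconnect_orbit.
transitivity (\sum_(v | fconnect r u v) ((ccw t (r v))%:Z - (ccw t v)%:Z +
    (2 * n)%:Z * (passes A v t + passes B (f v) t))).
  apply: eq_bigr => v /fconnect_linked uv.
  have [uTA _] := andP (closed _ uv).
  have ufv : linked u (f v) by rewrite linked_mateA.
  have [_ uTB] := andP (closed _ ufv).
  rewrite (sweep_passes n_gt0 A_Mb (t := t)) ?neq // (negbTE uTA).
  rewrite (sweep_passes n_gt0 B_Mb (t := t)) ?neq ?linked_mateB // (negbTE uTB) /=.
  ring.
rewrite big_split sumrB /= [X in X - _ + _](_ : _ = \sum_(v | fconnect r u v) (ccw t v)%:Z).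
  by rewrite subrr add0r -big_distrr big_split.
rewrite [RHS](reindex_inj rI) /=.
by apply: eq_bigl => w; rewrite -same_fconnect1_r.
Qed.

Lemma winding0 p q u : p \in through A -> q \in through B -> linked p q ->
  ~~ linked u p -> winding A B u = 0.
Proof.
move=> pA qB pq up.
have closed v : linked u v -> (v \notin through A) && (v \notin through B).
  move=> uv; apply/andP; split; apply: contra up => vT.
    have [E|E] := through_mate n_gt0 A_Mb vT pA; rewrite E //.
    by rewrite linked_mateA.
  have : linked u q.
    have [E|E] := through_mate n_gt0 B_Mb vT qB; rewrite E //.
    by rewrite linked_mateB.
  by move/connect_trans; apply; rewrite linked_sym.
have off t : linked p t -> ~~ linked u t.
  move=> pt; apply: contra up => /connect_trans; apply.
  by rewrite linked_sym.
have neq t v : linked p t -> linked u v -> t != v.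
  by move=> /off ut uv; apply: contraNneq ut => ->.
have wind t pt := winding_passings (off t pt) closed.
have N_neq0 : (2 * n)%:Z != 0 by rewrite eqz_nat; lia.
have sum_const s t : linked p s -> linked p t ->
    passings A id u s + passings B f u s = passings A id u t + passings B f u t.
  by move=> ps pt; apply: (mulfI N_neq0); rewrite -!wind.
have A_const t : linked p t -> passings A id u (f t) = passings A id u t.
  move=> pt; apply: eq_bigr => v /fconnect_linked uv.
  by apply: (passes_mate n_gt0 A_Mb); apply: neq; rewrite ?linked_mateA.
have B_const t : linked p t -> passings B f u (g t) = passings B f u t.
  move=> pt; apply: eq_bigr => v /fconnect_linked uv.
  by apply: (passes_mate n_gt0 B_Mb); apply: neq; rewrite ?linked_mateB ?linked_mateA.
(* An arc of [B] fixes the passings of [B]; since the sum of both numbers is constant, it fixes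
   those of [A] too. *)
have zero i : passings A id u (walk f g p i) = 0.
  elim: i => [|i IHi].
    by rewrite /passings big1 // => v _; apply: (passes_through n_gt0 A_Mb).
  have pi := connect_walk f g p i.
  rewrite walkS; case: odd; last by rewrite A_const.
  have := sum_const _ _ pi (_ : linked p (g (walk f g p i))).
  by rewrite linked_mateB B_const // => /(_ pi) /addIr <-.
have [i _ q_eq] := connect_gluedP fK gK p q pq.
rewrite (wind q pq) {1}q_eq zero /passings big1 ?addr0 ?mulr0 // => v _.
exact: (passes_through n_gt0 B_Mb).
Qed.

End Curves.

(** * State sum for the Gram matrix *)

Section States.

Variable n : nat.
Implicit Types (A B : {set arc n}) (S : {set point n}) (v : point n).

(* A state orients all arcs of a connection; [S] is the set of the marked points
   at which the orientation points out of the Moebius band, and both ends of the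
   arc through the crosscap point into it. *)
Definition compatible A S : bool :=
  [forall v in through A, v \notin S]
  && [forall a in A, (a.1 \in S) (+) (a.2 \in S)].

(** The arcs oriented counterclockwise. Exponents 1 and 0 replace the symmetric 1/2 and -1/2, which
    accounts for the factor [q ^ (n - 1)] in the state sum. *)
Definition weight A S : nat := #|[set a in A | a.2 \in S]|.

Section Compatible.

Variables (A : {set arc n}) (S : {set point n}).
Hypotheses (n_gt0 : (0 < n)%N) (A_Mb : A \in Mb n).

Lemma compatibleP :
  reflect ((forall v, v \in through A -> v \notin S) /\
           (forall v, v \notin through A -> (mate A v \in S) = (v \notin S)))
          (compatible A S).
Proof.
apply: (iffP andP) => [[/forall_inP thr /forall_inP flip]|[thr flip]].
  split=> // v vT; have [a aA end_a] := notin_throughP _ _ vT.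
  have := flip a aA; case/orP: end_a => /eqP ->;
  by rewrite ?(mate_source n_gt0 A_Mb aA) ?(mate_target n_gt0 A_Mb aA);
    do 2 case: (_ \in S).
split; apply/forall_inP => // a aA.
rewrite -(mate_source n_gt0 A_Mb aA) flip; first by case: (_ \in S).
by apply/notin_throughP; exists a => //; rewrite /endpoint eqxx.
Qed.

Hypothesis S_A : compatible A S.

Lemma sum_compatible (F : point n -> int) :
  \sum_(v in S) F v = \sum_(v | v \notin through A) F v *+ (v \in S).
Proof.
have [thr _] := compatibleP S_A.
rewrite big_mkcond [RHS]big_mkcond; apply: eq_bigr => v _.
by case: (boolP (v \in through A)) => [/thr/negbTE ->|_] //=; case: (v \in S).
Qed.

Lemma weight_sum : (weight A S)%:Z *+ 2 = \sum_(v in S) (1 - orientation A v).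
Proof.
have A_nc := Mb_nc A_Mb.
rewrite sum_compatible (sum_endpoints A_nc).
have -> : (weight A S)%:Z = \sum_(a in A) (a.2 \in S)%:R.
  rewrite /weight -sum1_card -natz natr_sum big_mkcond [RHS]big_mkcond /=.
  by apply: eq_bigr => a _; rewrite inE; case: (a \in A) => //=; case: (_ \in S).
rewrite -sumrMnl; apply: eq_bigr => a aA.
have E1 : orientation A a.1 = 1.
  rewrite /orientation (mate_source n_gt0 A_Mb aA) -surjective_pairing aA.
  case: (boolP ((a.2, a.1) \in A)) => // a'A.
  have /= := arc_unique (v := a.1) A_nc aA a'A.
  rewrite /endpoint /= !eqxx orbT => /(_ isT isT) E.
  by have := arc_neq A_nc aA; rewrite {1}E eqxx.
have E2 : orientation A a.2 = -1.
  by rewrite -(mate_source n_gt0 A_Mb aA) (orientation_mate n_gt0 A_Mb) E1.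
by rewrite E1 E2 subrr opprK mul0rn add0r -mulrnA mulnC mulrnA.
Qed.

Lemma card_compatible : #|S| = n.-1.
Proof.
apply/eqP; rewrite -eqz_nat -(Mb_card A_Mb) -!natz.
have -> : #|S|%:R = \sum_(v in S) (1 : int) by rewrite sumr_const.
rewrite sum_compatible (sum_endpoints (Mb_nc A_Mb)) -sum1_card natr_sum.
apply/eqP/eq_bigr => a aA.
have /andP[_ /forall_inP/(_ a aA)] := S_A.
by do 2 case: (_ \in S).
Qed.

End Compatible.

Lemma weight_tilt A B S : (0 < n)%N -> A \in Mb n -> B \in Mb n ->
  compatible A S -> compatible B S ->
  (weight A S + weight B S)%N%:Z *+ 2 =
  n.-1%:Z *+ 2 - \sum_(v in S) tilt A B v.
Proof.
move=> n_gt0 A_Mb B_Mb A_S B_S.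
rewrite PoszD mulrnDl !weight_sum // -big_split /=.
have -> : n.-1%:Z *+ 2 = \sum_(v in S) (2 : int).
  by rewrite sumr_const (card_compatible n_gt0 A_Mb A_S) -natz -!mulrnA mulnC.
by rewrite -sumrB; apply: eq_bigr => v _; rewrite /tilt; ring.
Qed.

End States.

(** * States on the curves through the crosscaps *)

Section Obstructed.

Variables (n : nat) (A B : {set arc n}) (S : {set point n}) (q : point n).
Hypotheses (n_gt0 : (0 < n)%N) (A_Mb : A \in Mb n) (B_Mb : B \in Mb n).
Hypotheses (A_S : compatible A S) (B_S : compatible B S).
Local Notation f := (mate A).
Local Notation g := (mate B).

(* The arcs that connect the two ends of the arc of [B] through its crosscap
   alternate between [A] and [B] and are odd in number. *)
Lemma no_compatible : q \in through B ->
  (forall v, connect (glued f g) q v -> v \notin through A) -> False.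
Proof.
move=> qB offA; pose V := walk f g q; pose L := walk_length f g q.
have fK := mateK n_gt0 A_Mb; have gK := mateK n_gt0 B_Mb.
have f_fix := mate_fix n_gt0 A_Mb; have g_fix := mate_fix n_gt0 B_Mb.
have L_gt0 : (0 < L)%N := walk_length_gt0 f g q.
have last : V L.-1 = g q by rewrite -(walk_last fK gK q) gK.
have [thrA flipA] := compatibleP S n_gt0 A_Mb A_S.
have [thrB flipB] := compatibleP S n_gt0 B_Mb B_S.
have key i : (i < L)%N -> (V i \in S) = odd i.
  elim: i => [|i IHi] lt_i; first by apply: negbTE; apply: thrB.
  have {}IHi := IHi (ltnW lt_i); rewrite /V walkS -/(V i) /=.
  case: ifP IHi => odd_i IHi; last by rewrite flipA ?IHi // offA ?connect_walk.
  rewrite flipB ?IHi //; apply/negP => /(through_mate n_gt0 B_Mb qB)[|].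
    by move/(walk_inj fK gK f_fix g_fix (u := q) (j := 0%N) (ltnW lt_i) L_gt0) => i0;
      rewrite i0 in odd_i.
  have lt_last : (L.-1 < L)%N by rewrite prednK.
  rewrite -last => /(walk_inj fK gK f_fix g_fix (ltnW lt_i) lt_last) i_eq.
  by move: lt_i; rewrite i_eq prednK // ltnn.
have : V L.-1 \notin S by rewrite last thrB // (mate_through n_gt0 B_Mb).
rewrite key; first by move: L_gt0; rewrite /L /walk_length; lia.
by rewrite prednK.
Qed.

End Obstructed.

Lemma sum_even_after (F : nat -> int) b k : odd b ->
  \sum_(b <= i < b.+1 + k.*2 | ~~ odd i) F i = \sum_(0 <= i < k) F (b.+1 + i.*2)%N.
Proof.
move=> odd_b; elim: k => [|k IHk].
  by rewrite addn0 big_mkcond big_nat1 odd_b big_nil.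
have le_b : (b <= b.+1 + k.*2)%N by rewrite addSnnS leq_addr.
rewrite doubleS !addnS big_mkcond big_nat_recr ?(leqW le_b) //=.
rewrite big_nat_recr //= -big_mkcond IHk [RHS]big_nat_recr //=.
by rewrite oddD odd_double addbF odd_b addr0.
Qed.

Section ThroughCurve.

Variables (n : nat) (A B : {set arc n}) (p q : point n).
Hypotheses (n_gt0 : (0 < n)%N) (A_Mb : A \in Mb n) (B_Mb : B \in Mb n).
Local Notation f := (mate A).
Local Notation g := (mate B).
Local Notation linked := (connect (glued f g)).
Hypotheses (pA : p \in through A) (qB : q \in through B) (pq : linked p q).

Let fK := mateK n_gt0 A_Mb.
Let gK := mateK n_gt0 B_Mb.
Let f_fix := mate_fix n_gt0 A_Mb.
Let g_fix := mate_fix n_gt0 B_Mb.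

Local Notation V := (walk g f p).
Local Notation L := (walk_length g f p).

Let V_inj i j : (i < L)%N -> (j < L)%N -> V i = V j -> i = j.
Proof. exact: walk_inj. Qed.

Let L_gt0 : (0 < L)%N := walk_length_gt0 g f p.

Let odd_predL : odd L.-1.
Proof. by move: L_gt0; rewrite /walk_length; lia. Qed.

Let V_last : V L.-1 = f p.
Proof. by rewrite -[in RHS](walk_last gK fK p) fK. Qed.

Lemma linked_walkP v :
  reflect (exists2 i, (i < L)%N & v = V i) (linked p v).
Proof.
rewrite (eq_connect (_ : glued f g =2 glued g f)).
  exact: (connect_gluedP gK fK).
by move=> s t; rewrite /glued /= orbC.
Qed.

(* The walk from [p] starts with an arc of [B], first meets the crosscap of [B]
   between the steps [2 l] and [2 l + 1], and returns to [p] through the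
   crosscap of [A]. *)
Lemma through_times : exists l, [/\ (l.*2.+1 < L)%N,
  forall i, (i < L)%N -> (V i \in through B) = (i == l.*2) || (i == l.*2.+1) &
  forall i, (i < L)%N -> (V i \in through A) = (i == 0%N) || (i == L.-1)].
Proof.
have ex_i : exists i, (i < L)%N && (V i \in through B).
  by have /linked_walkP[i lt_i q_eq] := pq; exists i; rewrite lt_i -q_eq.
have [i0 /andP[lt_i0 i0B] i0_min] := ex_minnP ex_i.
(* An odd time is reached along an arc of [B], here the through arc, whose other end would have been
   met earlier. *)
have ev_i0 : ~~ odd i0.
  apply/negP => odd_i0; have i0_gt0 : (0 < i0)%N by case: i0 odd_i0 {lt_i0 i0B i0_min}.
  have := i0_min i0.-1; rewrite (leq_ltn_trans (leq_pred _) lt_i0) /=.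
  suff -> : V i0.-1 \in through B by move=> /(_ isT); lia.
  rewrite -(mate_through n_gt0 B_Mb) -[X in X \in _](_ : V i0 = _) //.
  by rewrite -{1}(prednK i0_gt0) walkS; have -> : odd i0.-1 = false by lia.
have i0E : i0 = i0./2.*2 by lia.
exists i0./2; rewrite -i0E; split=> [|i lt_i|i lt_i].
- by move: lt_i0 ev_i0; rewrite /walk_length; lia.
- have nextE : V i0.+1 = g (V i0) by rewrite walkS (negbTE ev_i0).
  have lt_next : (i0.+1 < L)%N by move: lt_i0 ev_i0; rewrite /walk_length; lia.
  apply/idP/orP => [/(through_mate n_gt0 B_Mb i0B)[/V_inj|]|[]/eqP ->] //.
  + by move=> ->; rewrite ?eqxx //; left.
  + by rewrite -nextE => /V_inj ->; rewrite ?eqxx //; right.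
  by rewrite nextE (mate_through n_gt0 B_Mb).
have lt_last : (L.-1 < L)%N by rewrite prednK.
apply/idP/orP => [/(through_mate n_gt0 A_Mb pA)[|]|[]/eqP ->] //.
- by move/(V_inj (j := 0%N) lt_i L_gt0) => ->; left.
- by rewrite -V_last => /V_inj ->; rewrite ?eqxx //; right.
by rewrite V_last (mate_through n_gt0 A_Mb).
Qed.

Lemma walk_reversed i : (i < L)%N -> walk g f (f p) i = V (L.-1 - i).
Proof.
elim: i => [|i IHi] lt_i; first by rewrite subn0 V_last.
rewrite walkS IHi ?(ltnW lt_i) //.
have -> : (L.-1 - i = (L.-1 - i.+1).+1)%N by lia.
rewrite walkS; move: odd_predL => odd_L.
case odd_i: (odd i).
  have -> : odd (L.-1 - i.+1) by lia.
  by rewrite fK.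
have -> : odd (L.-1 - i.+1) = false by lia.
by rewrite gK.
Qed.

(** A compatible state alternates along the curve except across the two through arcs, where its
    values are prescribed, so only one is possible. The curve consists of two stretches between the
    crosscaps, and each has total tilt 0 by [tilt_through]. *)
Lemma through_state : exists2 s : pred (point n),
    [/\ forall S, compatible A S -> compatible B S ->
          forall v, linked p v -> (v \in S) = s v,
        forall v, linked p v -> v \in through A -> ~~ s v,
        forall v, linked p v -> v \in through B -> ~~ s v,
        forall v, linked p v -> v \notin through A -> s (f v) = ~~ s v &
        forall v, linked p v -> v \notin through B -> s (g v) = ~~ s v]
  & \sum_(v | linked p v && s v) tilt A B v = 0.
Proof.
have [l [lt_l thrB thrA]] := through_times.
(* The alternation is broken from time [2 l] to [2 l + 1], where the through arc of [B] has both
   ends outside the state. *)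
pose c i := odd i (+) (l.*2 < i)%N.
pose s v := [exists i : 'I_L, (V i == v) && c i].
have sE i : (i < L)%N -> s (V i) = c i.
  move=> lt_i; apply/existsP/idP => [[j /andP[/eqP/V_inj -> //]]|ci].
  by exists (Ordinal lt_i); rewrite eqxx.
have c_flip i : i <> l.*2 -> c i.+1 = ~~ c i.
  by move=> neq; rewrite /c /=; lia.
exists s; first split.
- move=> S A_S B_S v /linked_walkP[i lt_i ->]; rewrite sE //.
  have [thrA' flipA] := compatibleP S n_gt0 A_Mb A_S.
  have [thrB' flipB] := compatibleP S n_gt0 B_Mb B_S.
  elim: i lt_i => [|i IHi] lt_i; first exact/negbTE/thrA'.
  have {}IHi := IHi (ltnW lt_i).
  have [i_l|i_l] := eqVneq i l.*2.
    rewrite i_l /c /= odd_double ltnSn; apply/negbTE/thrB'.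
    by rewrite thrB ?eqxx ?orbT.
  rewrite c_flip -?IHi; last exact/eqP.
  rewrite walkS; case odd_i: (odd i).
    have iA : V i \notin through A by rewrite thrA ?(ltnW lt_i) //; clear -lt_i odd_i; lia.
    exact (flipA _ iA).
  have iB : V i \notin through B by rewrite thrB ?(ltnW lt_i) //; clear -i_l odd_i; lia.
  exact (flipB _ iB).
- move=> v /linked_walkP[i lt_i ->]; rewrite thrA // sE // /c => /orP[]/eqP ->.
    by [].
  by rewrite odd_predL; lia.
- move=> v /linked_walkP[i lt_i ->]; rewrite thrB // sE // /c => /orP[]/eqP ->.
    by rewrite odd_double ltnn.
  by rewrite /= odd_double ltnSn.
- move=> v /linked_walkP[i lt_i ->]; rewrite thrA // => /norP[/eqP i0 /eqP iL].
  case odd_i: (odd i).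
    have -> : f (V i) = V i.+1 by rewrite walkS odd_i.
    by rewrite !sE //; [apply: c_flip | ]; lia.
  have i_eq : i = i.-1.+1 by lia.
  have -> : f (V i) = V i.-1.
    by rewrite i_eq walkS; have -> : odd i.-1 by lia.
  rewrite !sE //; last by lia.
  by rewrite {2}i_eq c_flip ?negbK //; lia.
- move=> v /linked_walkP[i lt_i ->]; rewrite thrB // => /norP[/eqP il /eqP il'].
  case odd_i: (odd i); last first.
    have -> : g (V i) = V i.+1 by rewrite walkS odd_i.
    by rewrite !sE //; [apply: c_flip | move: odd_predL]; lia.
  have i_eq : i = i.-1.+1 by lia.
  have -> : g (V i) = V i.-1.
    by rewrite i_eq walkS; have -> : odd i.-1 = false by lia.
  rewrite !sE //; last by lia.
  by rewrite {2}i_eq c_flip ?negbK //; lia.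
have tiltC v : tilt A B v = tilt B A v by rewrite /tilt addrC.
transitivity (\sum_(i < L | c i) tilt B A (V i)).
  rewrite (reindex_onto (fun i : 'I_L => V i)
    (fun v => odflt (Ordinal L_gt0) [pick i : 'I_L | V i == v])); last first.
    move=> v /andP[/linked_walkP[i lt_i v_eq] _].
    by case: pickP => [j /eqP //|/(_ (Ordinal lt_i))]; rewrite v_eq eqxx.
  apply: eq_big => [i|i _]; last exact: tiltC.
  have -> : linked p (V i) by apply/linked_walkP; exists i.
  rewrite sE //= andbC; case: pickP => [j /eqP/V_inj E /=|/(_ i)].
    by rewrite -val_eqE /= E ?eqxx.
  by rewrite eqxx.
rewrite -(big_mkord c (fun i => tilt B A (V i))).
rewrite (big_cat_nat _ (n := l.*2.+1)) //=; last exact: ltnW.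
rewrite [X in X + _](_ : _ = 0); last first.
  rewrite -[RHS](tilt_through n_gt0 B_Mb A_Mb (u := p) (l := l)) //; last first.
  - move=> i lt_i; rewrite /through_free; case odd_i: (odd i).
      by rewrite thrA; lia.
    by rewrite thrB; lia.
  - by rewrite thrB ?eqxx // ltnW.
  - exact: ltnW.
  have : forall i, (i < l.*2.+1)%N -> c i = odd i by move=> i lt_i; rewrite /c; lia.
  move=> c_odd; rewrite big_nat_cond.
  rewrite (eq_bigl (fun i => (0 <= i < l.*2.+1)%N && odd i)); last first.
    by move=> i; case: (boolP (_ <= _ < _)%N) => // lt_i; rewrite c_odd.
  rewrite -big_nat_cond; elim: (l) => [|k IHk]; first by rewrite big_mkcond big_nat1 big_nil.
  rewrite doubleS big_mkcond big_nat_recr //= big_nat_recr //= -big_mkcond IHk.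
  by rewrite odd_double /= addr0 [RHS]big_nat_recr.
(* The second stretch is read backwards from [f p], so that it too starts at the crosscap of [A]
   with an arc of [B]. *)
rewrite add0r; pose l' := (L.-1 - l.*2.+1)./2.
have l'E : (l'.*2 = L.-1 - l.*2.+1)%N by rewrite /l'; move: odd_predL; lia.
have lt_L' : (l'.*2 < L)%N by lia.
have le_L : (L <= walk_length g f (f p))%N.
  rewrite leqNgt; apply/negP => lt_L.
  have := walk_periodic gK fK (f p) 0; rewrite add0n walk_reversed // walk0 => e.
  have lt_pred k : (L.-1 - k < L)%N by lia.
  have e0 : f p = V (L.-1 - 0) by rewrite subn0 V_last.
  have := V_inj (lt_pred _) (lt_pred _) (etrans e e0).
  have := walk_length_gt0 g f (f p); lia.
have Vr i : (i < L)%N -> walk g f (f p) i = V (L.-1 - i) by apply: walk_reversed.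
have := tilt_through n_gt0 B_Mb A_Mb (u := f p) (l := l').
move=> /(_ (leq_trans lt_L' le_L)).
rewrite (mate_through n_gt0 A_Mb) => /(_ pA).
rewrite Vr // thrB; last by lia.
have -> : (L.-1 - l'.*2 = l.*2.+1)%N by lia.
rewrite eqxx orbT => /(_ isT) H; rewrite -[RHS]H => [|i lt_i]; last first.
  rewrite /through_free Vr; last by lia.
  case odd_i: (odd i).
    by rewrite thrA; lia.
  by rewrite thrB; lia.
have -> : \sum_(l.*2.+1 <= i < L | c i) tilt B A (V i) =
    \sum_(0 <= i < l') tilt B A (V (l.*2.+2 + i.*2)%N).
  have {1}-> : L = (l.*2.+2 + l'.*2)%N by lia.
  rewrite -(sum_even_after (fun i => tilt B A (V i)) l' (b := l.*2.+1)); last first.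
    by rewrite /= odd_double.
  rewrite big_nat_cond [RHS]big_nat_cond; apply: eq_bigl => i; rewrite /c.
  by case: (boolP (_ <= _ < _)%N) => //= ?; lia.
rewrite big_nat_rev; apply: eq_big_nat => i lt_i; rewrite Vr; last by lia.
by congr (tilt _ _ (V _)); lia.
Qed.

End ThroughCurve.

(** * Summation over the states *)

Section SubsetSum.

Variables (R : comNzRingType) (I : finType) (q q' : R).
Hypothesis qq' : q * q' = 1.

(** Expansion of the product: [J] collects the factors that contribute [q], the others contribute
    [q']. The hypothesis on [e] expresses the exponent without subtraction. *)
Lemma sum_subsets (C : {set I}) (m : nat) (e : {set I} -> nat) :
  (forall J : {set I}, J \subset C -> (e J + #|C| = m + 2 * #|J|)%N) ->
  \sum_(J : {set I} | J \subset C) q ^+ e J = q ^+ m * (q + q') ^+ #|C|.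
Proof.
move=> eE; have q'_reg k : q ^+ k * q' ^+ k = 1 by rewrite -exprMn qq' expr1n.
have -> : (q + q') ^+ #|C| =
    \prod_(i : I) ((if i \in C then q else 0) + (if i \in C then q' else 1)).
  rewrite -prodr_const big_mkcond; apply: eq_bigr => i _.
  by case: ifP; rewrite ?add0r.
rewrite bigA_distr big_distrr /= [LHS]big_mkcond; apply: eq_bigr => J _.
case: (boolP (J \subset C)) => [sJC|/subsetPn[i iJ iC]]; last first.
  by rewrite (bigD1 i) //= iJ (negbTE iC) mul0r mulr0.
have -> : \prod_i (if i \in J then if i \in C then q else 0
    else if i \in C then q' else 1) = q ^+ #|J| * q' ^+ #|C :\: J|.
  rewrite -!prodr_const [X in _ = X * _]big_mkcond [X in _ = _ * X]big_mkcond.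
  rewrite -big_split /=.
  apply: eq_bigr => i _; rewrite inE; case: (boolP (i \in J)) => [iJ|_].
    by rewrite (subsetP sJC) //= mulr1.
  by rewrite mul1r.
have cE := eE J sJC.
have cC : #|C| = (#|J| + #|C :\: J|)%N.
  by rewrite -(cardsID J C) (setIidPr sJC).
rewrite mulrA -exprD; have -> : (m + #|J| = e J + #|C :\: J|)%N by lia.
by rewrite exprD -mulrA q'_reg mulr1.
Qed.

End SubsetSum.

Section StateSum.

Variables (n : nat) (A B : {set arc n}).
Hypotheses (n_gt0 : (0 < n)%N) (A_Mb : A \in Mb n) (B_Mb : B \in Mb n).
Implicit Types (u v w p : point n) (S C : {set point n}) (J : {set {set point n}}).

Local Notation f := (mate A).
Local Notation g := (mate B).
Local Notation linked := (connect (glued f g)).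

Let fK := mateK n_gt0 A_Mb.
Let gK := mateK n_gt0 B_Mb.

Lemma crosses_curveP (A' : {set arc n}) u :
  reflect (exists2 v, linked u v & v \in through A') (crosses A' (curve A B u)).
Proof.
apply: (iffP pred0Pn) => [[v /andP[uv vT]]|[v uv vT]]; exists v => //=.
  by rewrite -in_curve.
by rewrite vT andbT in_curve.
Qed.

Lemma curvesP C : reflect (exists u, C = curve A B u) (C \in curves A B).
Proof. by apply: (iffP imsetP) => [[u _ ->]|[u ->]]; exists u. Qed.

Lemma nb_right_neq0 : nb_right A B != 0%N ->
  exists2 p, p \in through B & forall v, linked p v -> v \notin through A.
Proof.
rewrite -lt0n => /card_gt0P[C]; rewrite inE => /andP[/curvesP[u ->]].
case/andP => /crosses_curveP[p up pB] /crosses_curveP no_A; exists p => // v pv.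
by apply/negP => vA; apply: no_A; exists v => //; apply: connect_trans pv.
Qed.

Section Crossing.

Variables (p p' : point n).
Hypotheses (pA : p \in through A) (pB : p' \in through B) (pp' : linked p p').

Lemma crossing_linked u : crosses A (curve A B u) || crosses B (curve A B u) ->
  curve A B u = curve A B p.
Proof.
move=> cr; apply/eqP; rewrite curve_eq //.
case/orP: cr => /crosses_curveP[v uv vT].
  have [E|E] := through_mate n_gt0 A_Mb vT pA; rewrite E //.
  by rewrite linked_mateA.
have : linked u p'.
  have [E|E] := through_mate n_gt0 B_Mb vT pB; rewrite E //.
  by rewrite linked_mateB.
by move/connect_trans; apply; rewrite linked_sym.
Qed.

Lemma crosses_A : crosses A (curve A B p).
Proof. by apply/crosses_curveP; exists p. Qed.

Lemma crosses_B : crosses B (curve A B p).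
Proof. by apply/crosses_curveP; exists p'. Qed.

Lemma not_winding u : ~~ linked u p -> ~~ winds A B (curve A B u).
Proof.
move=> up; apply/existsP => -[v /andP[]]; rewrite in_curve // => uv.
rewrite (winding0 n_gt0 A_Mb B_Mb pA pB pp') ?eqxx //.
by apply: contra up; apply: connect_trans.
Qed.

Lemma trivial_curves :
  [set C in curves A B | [&& ~~ crosses A C, ~~ crosses B C & ~~ winds A B C]]
  = curves A B :\ curve A B p.
Proof.
apply/setP => C; rewrite in_set in_setD1 andbC.
case: (boolP (C \in curves A B)) => [/curvesP[u ->]|_]; rewrite ?andbF ?andbT //=.
apply/idP/idP => [|neq].
  by apply: contraL => /eqP ->; rewrite crosses_A.
rewrite -!negb_or orbA negb_or not_winding ?andbT -?curve_eq //.
by apply: contra neq => /crossing_linked ->.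
Qed.

Lemma nb_left0 : nb_left A B = 0%N.
Proof.
apply/eqP; rewrite cards_eq0; apply/eqP/setP => C; rewrite in_set in_set0.
apply/negP => /andP[/curvesP[u ->] /andP[crA]]; apply/negP/negPn.
by rewrite crossing_linked ?crA // crosses_B.
Qed.

Lemma nb_separating0 : nb_separating A B = 0%N.
Proof.
apply/eqP; rewrite cards_eq0; apply/eqP/setP => C; rewrite in_set in_set0.
apply/negP => /andP[/curvesP[u ->] /and3P[crA _]]; apply/negP/not_winding.
by apply: contra crA => up; apply/crosses_curveP; exists p.
Qed.

Lemma compatible_fconnect S : compatible A S -> compatible B S ->
  forall u v, ~~ linked u p -> fconnect (g \o f) u v -> (v \in S) = (u \in S).
Proof.
move=> A_S B_S u v up /iter_findex <-.
have [_ flipA] := compatibleP S n_gt0 A_Mb A_S.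
have [_ flipB] := compatibleP S n_gt0 B_Mb B_S.
have off w : linked u w -> w \notin through A /\ w \notin through B.
  move=> uw; split; apply: contra up => wT.
    rewrite -curve_eq // crossing_linked //; apply/orP; left.
    by apply/crosses_curveP; exists w.
  rewrite -curve_eq // crossing_linked //; apply/orP; right.
  by apply/crosses_curveP; exists w.
elim: findex => //= i IHi.
have ui : linked u (iter i (g \o f) u).
  by apply: fconnect_linked => //; apply: fconnect_iter.
have [iA _] := off _ ui.
have [_ fiB] := off (f (iter i (g \o f) u)) ltac:(by rewrite linked_mateA).
by rewrite flipB // flipA // negbK.
Qed.

Let trivials : {set {set point n}} := curves A B :\ curve A B p.

Lemma curve_trivial u : ~~ linked u p -> curve A B u \in trivials.
Proof.
by move=> up; rewrite in_setD1 curve_eq // up; apply/curvesP; exists u.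
Qed.

Lemma chi_trivial u : ~~ linked u p -> chi A B u = 2 \/ chi A B u = -2.
Proof.
move=> up; apply: (chi_loop n_gt0 A_Mb B_Mb); last first.
  exact: (winding0 n_gt0 A_Mb B_Mb pA pB pp').
move=> v uv; rewrite -negb_or; apply: contra up => vT.
rewrite -curve_eq // crossing_linked //.
case/orP: vT => vT; apply/orP; [left | right];
by apply/crosses_curveP; exists v.
Qed.

Lemma through_linkedA v : v \in through A -> linked p v.
Proof.
move=> vA; have [->|->] := through_mate n_gt0 A_Mb pA vA; first exact: connect0.
by rewrite linked_mateA // connect0.
Qed.

Lemma through_linkedB v : v \in through B -> linked p v.
Proof.
move=> vB; have [->|->] := through_mate n_gt0 B_Mb pB vB; first exact: pp'.
by rewrite linked_mateB.
Qed.

Variable s : pred (point n).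

(* The compatible states that restrict to [s] on the curve through the
   crosscaps are parametrized by the set of the trivial curves on which the
   points of the state are those with [chi] equal to -2. *)
Definition state_of (J : {set {set point n}}) : {set point n} :=
  [set v | if linked p v then s v
           else (chi A B v == -2) == (curve A B v \in J)].

Definition code_of S : {set {set point n}} :=
  [set C in trivials | [exists v in S, (curve A B v == C) && (chi A B v == -2)]].

Lemma chi_flip v : ~~ linked p v -> (- chi A B v == -2) = (chi A B v != -2).
Proof. by rewrite linked_sym // => /chi_trivial[] ->. Qed.

Lemma curve_mateA v : curve A B (f v) = curve A B v.
Proof. by apply/eqP; rewrite curve_eq // linked_sym // linked_mateA // connect0. Qed.

Lemma curve_mateB v : curve A B (g v) = curve A B v.
Proof. by apply/eqP; rewrite curve_eq // linked_sym // linked_mateB // connect0. Qed.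

Lemma state_of_compatibleA J :
  (forall v, linked p v -> v \in through A -> ~~ s v) ->
  (forall v, linked p v -> v \notin through A -> s (f v) = ~~ s v) ->
  compatible A (state_of J).
Proof.
move=> s_thr s_flip; apply/(compatibleP _ n_gt0 A_Mb); split=> v vA.
  by rewrite inE through_linkedA // s_thr // through_linkedA.
rewrite !inE linked_mateA //; case: ifP => [pv|/negbT pv]; first exact: s_flip.
rewrite chi_mateA // chi_flip // curve_mateA.
by case: (_ == -2); case: (_ \in J).
Qed.

Lemma state_of_compatibleB J :
  (forall v, linked p v -> v \in through B -> ~~ s v) ->
  (forall v, linked p v -> v \notin through B -> s (g v) = ~~ s v) ->
  compatible B (state_of J).
Proof.
move=> s_thr s_flip; apply/(compatibleP _ n_gt0 B_Mb); split=> v vB.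
  by rewrite inE through_linkedB // s_thr // through_linkedB.
rewrite !inE linked_mateB //; case: ifP => [pv|/negbT pv]; first exact: s_flip.
rewrite chi_mateB // chi_flip // curve_mateB.
by case: (_ == -2); case: (_ \in J).
Qed.

(** Both values occur on every trivial curve because [mate A] stays on the curve and negates
    [chi]. *)
Lemma trivialsP C : C \in trivials ->
  forall x : int, x = 2 \/ x = -2 ->
  exists2 u, ~~ linked p u & C = curve A B u /\ chi A B u = x.
Proof.
case/setD1P => neq /curvesP[u C_eq] x x_eq.
have pu : ~~ linked p u by rewrite linked_sym // -curve_eq // -C_eq.
have fu : ~~ linked p (f u) by rewrite linked_mateA.
have [E|E] : chi A B u = x \/ chi A B (f u) = x.
  rewrite chi_mateA //; move: (pu); rewrite linked_sym // => /chi_trivial[] ->;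
  case: x_eq => ->; by [left | right].
  by exists u.
by exists (f u) => //; rewrite curve_mateA.
Qed.

Lemma code_of_sub S : code_of S \subset trivials.
Proof. by apply/subsetP => C; rewrite inE => /andP[]. Qed.

Lemma state_ofK J : J \subset trivials -> code_of (state_of J) = J.
Proof.
move=> sJ; apply/setP => C; rewrite inE.
case: (boolP (C \in trivials)) => [C_triv|C_triv] /=; last first.
  by apply/esym/negbTE; apply: contra C_triv; apply/subsetP.
apply/exists_inP/idP => [[v]|CJ].
  rewrite inE => v_st /andP[/eqP C_eq chi_v]; move: v_st.
  rewrite chi_v C_eq; case: ifP => [pv|_ /eqP <- //].
  by case/setD1P: C_triv; rewrite -C_eq curve_eq // linked_sym // pv.
have [u pu [C_eq chi_u]] := trivialsP C_triv (or_intror erefl).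
exists u; last by rewrite -C_eq chi_u !eqxx.
by rewrite inE (negbTE pu) chi_u -C_eq CJ eqxx.
Qed.

Lemma code_ofK S : compatible A S -> compatible B S ->
  (forall v, linked p v -> (v \in S) = s v) -> state_of (code_of S) = S.
Proof.
move=> A_S B_S S_s; apply/setP => v; rewrite inE.
case: ifP => [pv|/negbT pv]; first by rewrite S_s.
have vp : ~~ linked v p by rewrite linked_sym.
have [_ flipA] := compatibleP S n_gt0 A_Mb A_S.
have vA : v \notin through A by apply: contra pv; apply: through_linkedA.
have same := compatible_fconnect A_S B_S.
have in_code : (curve A B v \in code_of S) =
    [exists w in S, linked v w && (chi A B w == -2)].
  rewrite inE curve_trivial //=; apply: eq_existsb => w.
  by rewrite curve_eq // linked_sym.
rewrite in_code; apply/eqP/idP => [E|vS].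
  case: (chi_trivial vp) => chi_v; move: E; rewrite chi_v.
    move/esym/negbT; rewrite negb_exists => /forallP/(_ (f v)).
    rewrite linked_mateA // connect0 chi_mateA // chi_v eqxx !andbT flipA //.
    by rewrite negbK.
  move/esym/exists_inP => [w wS /andP[]]; rewrite linkedE // => /orP[] vw chi_w.
    by rewrite (same v w vp vw) in wS.
  have E := chi_fconnect n_gt0 A_Mb B_Mb vw.
  by move: chi_w; rewrite -E chi_mateA // chi_v.
apply/idP/exists_inP => [chi_v|[w wS]]; first by exists v; rewrite ?connect0 ?chi_v.
rewrite linkedE // => /andP[/orP[] vw chi_w].
  by rewrite (chi_fconnect n_gt0 A_Mb B_Mb vw) (eqP chi_w).
have fvp : ~~ linked (f v) p by rewrite linked_sym // linked_mateA.
by move: wS; rewrite (same (f v) w fvp vw) flipA // vS.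
Qed.

Lemma sum_tilt_state_of J : J \subset trivials ->
  \sum_(v | linked p v && s v) tilt A B v = 0 ->
  \sum_(v in state_of J) tilt A B v = #|trivials|%:Z *+ 2 - #|J|%:Z *+ 4.
Proof.
move=> sJ s0; rewrite (bigID (linked p)) /=.
rewrite (eq_bigl (fun v => linked p v && s v)) => [|v]; last first.
  by rewrite inE andbC; case: (linked p v).
rewrite s0 add0r.
rewrite (partition_big (curve A B) (mem trivials)) /=; last first.
  by move=> v /andP[_ pv]; apply: curve_trivial; rewrite linked_sym.
transitivity (\sum_(C in trivials) (2 - (C \in J)%:R *+ 4 : int)); last first.
  rewrite sumrB sumr_const -mulrnA mulnC mulrnA natz; congr (_ - _).
  rewrite sumrMnl; congr (_ *+ _); rewrite -natz -sum1_card natr_sum.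
  rewrite big_mkcond [RHS]big_mkcond; apply: eq_bigr => C _ /=.
  case: (boolP (C \in J)) => [/(subsetP sJ) -> //|_].
  by case: ifP.
apply: eq_bigr => C C_triv; pose x : int := if C \in J then -2 else 2.
have [|u pu [C_eq chi_u]] := trivialsP C_triv (x := x).
  by rewrite /x; case: ifP; [right | left].
transitivity (chi A B u); last by rewrite chi_u /x; case: (C \in J).
rewrite {1}/chi; apply: eq_bigl => v; rewrite inE [in _ == C]C_eq.
have up : ~~ linked u p by rewrite linked_sym.
rewrite curve_eq // [linked v u]linked_sym //; apply/idP/idP.
  move=> /andP[/andP[]] + pv; rewrite (negbTE pv) => chi_v uv; move: chi_v.
  have -> : curve A B v = C by rewrite C_eq; apply/eqP; rewrite curve_eq // linked_sym.
  move: uv; rewrite linkedE // => /orP[//|fuv].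
  rewrite -(chi_fconnect n_gt0 A_Mb B_Mb fuv) chi_mateA // chi_u /x.
  by case: (C \in J).
move=> uv; have l_uv := fconnect_linked n_gt0 A_Mb B_Mb uv.
have pv : ~~ linked p v.
  by apply: contra pu => pv; apply: connect_trans pv _; rewrite linked_sym.
rewrite (negbTE pv) l_uv !andbT -(chi_fconnect n_gt0 A_Mb B_Mb uv) chi_u.
have -> : curve A B v = C by rewrite C_eq; apply/eqP; rewrite curve_eq // linked_sym.
by rewrite /x; case: (C \in J).
Qed.

End Crossing.

Lemma no_right_crossing : nb_right A B = 0%N ->
  exists p p', [/\ p \in through A, p' \in through B & linked p p'].
Proof.
move=> no_right.
have [p' p'B] : exists p', p' \in through B.
  by apply/card_gt0P; rewrite (card_through_Mb n_gt0 B_Mb).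
have cB : crosses B (curve A B p') by apply/crosses_curveP; exists p'.
have : ~~ (crosses B (curve A B p') && ~~ crosses A (curve A B p')).
  apply/negP => cr; have /eqP := no_right; rewrite cards_eq0 => /eqP/setP.
  by move=> /(_ (curve A B p')); rewrite in_set0 in_set cr andbT;
    move/negP; apply; apply/curvesP; exists p'.
rewrite cB negbK => /crosses_curveP[p pp' pA]; exists p, p'.
by rewrite linked_sym.
Qed.

Lemma no_right_no_left : nb_right A B = 0%N ->
  nb_left A B = 0%N /\ nb_separating A B = 0%N.
Proof.
case/no_right_crossing => p [p' [pA p'B pp']].
by split; [exact: nb_left0 pA p'B pp' | exact: nb_separating0 pA p'B pp'].
Qed.

Variables (R : comNzRingType) (q q' : R).
Hypothesis qq' : q * q' = 1.

Definition state_weight (A' : {set arc n}) S : R :=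
  if compatible A' S then q ^+ weight A' S else 0.

Lemma gram_state_sum :
  \sum_S state_weight A S * state_weight B S =
  q ^+ n.-1 * (if nb_right A B == 0%N then (q + q') ^+ nb_trivial A B else 0).
Proof.
case: (eqVneq (nb_right A B) 0%N) => [no_right|/nb_right_neq0[p pB offA]]; last first.
  rewrite mulr0 big1 // => S _; rewrite /state_weight.
  case A_S: (compatible A S); last by rewrite mul0r.
  case B_S: (compatible B S); last by rewrite mulr0.
  by case: (no_compatible n_gt0 A_Mb B_Mb A_S B_S pB offA).
have [p [p' [pA p'B pp']]] := no_right_crossing no_right.
have [s [S_s sA sB sfA sfB] s0] := through_state n_gt0 A_Mb B_Mb pA p'B pp'.
pose st := state_of p s; pose cd := code_of p.
have stA J : compatible A (st J) by apply: (state_of_compatibleA pA p'B pp').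
have stB J : compatible B (st J) by apply: (state_of_compatibleB pA p'B pp').
have -> : nb_trivial A B = #|curves A B :\ curve A B p|.
  by rewrite /nb_trivial (trivial_curves pA p'B pp').
(* A trivial curve contributes [q] if it belongs to [J], where its tilts add up to -2, and [q']
   otherwise. *)
rewrite -(sum_subsets qq' (e := fun J => (weight A (st J) + weight B (st J))%N)).
  transitivity (\sum_(S | compatible A S && compatible B S)
      q ^+ (weight A S + weight B S)).
    rewrite [RHS]big_mkcond; apply: eq_bigr => S _; rewrite /state_weight.
    case: (compatible A S); rewrite ?mul0r //.
    by case: (compatible B S); rewrite ?mulr0 // exprD.
  rewrite (reindex_onto st cd) => [|S /andP[A_S B_S]]; last first.
    exact: (code_ofK pA p'B pp' A_S B_S (S_s S A_S B_S)).
  apply: eq_bigl => J; rewrite stA stB /=.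
  apply/eqP/idP => [<-|]; first exact: code_of_sub.
  exact: (state_ofK pA p'B pp').
move=> J sJ; have := weight_tilt n_gt0 A_Mb B_Mb (stA J) (stB J).
rewrite (sum_tilt_state_of pA p'B pp' sJ s0).
set c := #|_ :\ _|; set e := (weight A _ + _)%N; set m := n.-1; lia.
Qed.

End StateSum.

(** * Four-ended connections *)

Section AddArc.

Variables (n : nat) (D : {set arc n}).
Hypothesis D_nc : noncrossing D.
Implicit Types (a : arc n) (v t : point n).

Lemma through_setU1 a v :
  (v \in through (a |: D)) = (v \in through D) && ~~ endpoint a v.
Proof.
apply/throughP/andP => [H|[/throughP H end_a] b].
  split; last by apply: H; rewrite setU11.
  by apply/throughP => b bD; apply: H; rewrite setU1r.
by case/setU1P => [->|/H].
Qed.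

Lemma through_notin a : a.1 \in through D -> a \notin D.
Proof. by move=> /throughP H; apply/negP => /H; rewrite /endpoint eqxx. Qed.

(** The ends of the new arc lie in no disk cut off by [D], so [disjoint_arcs_outside] applies; the
    last hypothesis keeps the remaining free ends outside its own disk. *)
Lemma noncrossing_setU1 a : a.1 != a.2 -> a.1 \in through D -> a.2 \in through D ->
  (forall t, t \in through D -> t \in under a -> endpoint a t) ->
  noncrossing (a |: D).
Proof.
move=> neq a1 a2 empty; apply/and3P; split.
- by apply/forall_inP => b /setU1P[->|/(arc_neq D_nc)].
- have dis b : b \in D -> disjoint_arcs a b.
    by move=> bD; apply: disjoint_arcs_outside;
      [exact (through_outside D_nc bD a1) | exact (through_outside D_nc bD a2)].
  apply/forall_inP => b /setU1P[->|bD]; apply/forall_inP => c /setU1P[->|cD];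
    apply/implyP => neq_bc.
  + by rewrite eqxx in neq_bc.
  + exact: dis.
  + by rewrite disjoint_arcsC; apply: dis.
  exact: (arc_disjoint D_nc).
apply/forall_inP => b bU; rewrite disjoint_subset; apply/subsetP => v.
rewrite through_setU1 => /andP[vD end_v]; rewrite inE.
case/setU1P: bU => [->|bD]; last exact (through_outside D_nc bD vD).
by apply: contra end_v; apply: empty.
Qed.

End AddArc.

Lemma ccw_between n (s t w : point n) : (ccw s w <= ccw s t)%N ->
  w != s -> w != t -> (ccw s w < ccw s t)%N /\ (ccw w t < ccw s t)%N.
Proof.
rewrite -!val_eqE /= => in_st neq_s neq_t.
move: (ccw_spec s w) (ccw_spec s t) (ccw_spec w t).
move: (ltn_ord s) (ltn_ord w) (ltn_ord t); lia.
Qed.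

Lemma outside_seam_arc n (s t w : point n) : (t < s)%N ->
  w \notin under (s, t) -> (w < s)%N.
Proof.
rewrite in_under /= => lt_ts; move: (ccw_spec s w) (ccw_spec s t).
move: (ltn_ord s) (ltn_ord w) (ltn_ord t); lia.
Qed.

(** * Cyclic parenthesis matching *)

Section Sources.

Variable n : nat.
Implicit Types (D : {set arc n}) (O : {set point n}) (a : arc n).

Definition sources D : {set point n} := [set a.1 | a in D].

Lemma card_sources D : noncrossing D -> #|sources D| = #|D|.
Proof.
move=> D_nc; apply: card_in_imset => a b aD bD E.
by apply: (arc_unique D_nc (v := a.1) aD bD); rewrite /endpoint ?E eqxx.
Qed.

Lemma add_source D O : noncrossing D -> sources D \subset O ->
  (forall a, a \in D -> a.2 \notin O) -> (#|D| < #|O| < n)%N ->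
  exists a, [/\ noncrossing (a |: D), sources (a |: D) \subset O,
    (forall b, b \in a |: D -> b.2 \notin O) & a \notin D].
Proof.
move=> D_nc sub_O tgt_O /andP[lt_DO lt_On].
have cS := card_sources D_nc; have cT := card_through D_nc.
have [s0 s0O s0T] : exists2 s0, s0 \in O & s0 \in through D.
  have : (0 < #|O :\: sources D|)%N.
    by have := cardsID (sources D) O; rewrite (setIidPr sub_O) cS; lia.
  case/card_gt0P => s0 /setDP[s0O s0S]; exists s0 => //.
  apply/throughP => a aD; rewrite negb_or; apply/andP; split; apply/eqP => E.
    by move: s0S; rewrite E imset_f.
  by move: s0O; rewrite E (negbTE (tgt_O a aD)).
(* If all free points were in [O], then together with the sources they would give [O] at least
   [2 n - #|D|] points, more than [n]. *)
have [t0 t0O t0T] : exists2 t0, t0 \notin O & t0 \in through D.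
  suff : (0 < #|through D :\: O|)%N by case/card_gt0P => t0 /setDP[]; exists t0.
  rewrite lt0n cards_eq0 setD_eq0; apply/negP => T_O.
  have : sources D :|: through D \subset O by rewrite subUset sub_O.
  move/subset_leq_card; rewrite cardsU disjoint_setI0 ?cards0 ?cS; first by lia.
  rewrite disjoint_subset; apply/subsetP => _ /imsetP[a aD ->].
  by rewrite inE; apply/notin_throughP; exists a => //; rewrite /endpoint eqxx.
pose P (a : arc n) := [&& a.1 \in O, a.1 \in through D, a.2 \notin O & a.2 \in through D].
have P0 : P (s0, t0) by rewrite /P /= s0O s0T t0O.
(* A closest pair of a free opening and a free closing has no free point strictly between, since
   such a point would form a closer pair with one of the two. *)
case: (arg_minnP (fun a : arc n => ccw a.1 a.2) P0) => -[s t] /and4P[/= sO sT tO tT] mn.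
have neq : s != t by apply: contraNneq tO => <-.
have empty w : w \in through D -> w \in under (s, t) -> endpoint (s, t) w.
  move=> wT; rewrite in_under /= => w_in; rewrite /endpoint /=.
  have [//|neq_s] := eqVneq w s; have [//|neq_t] := eqVneq w t.
  have [lt_sw lt_wt] := ccw_between w_in neq_s neq_t.
  case: (boolP (w \in O)) => wO.
    by have := mn (w, t); rewrite /P /= wO wT tO tT leqNgt lt_wt => /(_ isT).
  by have := mn (s, w); rewrite /P /= sO sT wO wT leqNgt lt_sw => /(_ isT).
exists (s, t); split.
- exact: noncrossing_setU1.
- apply/subsetP => _ /imsetP[b /setU1P[->|bD] ->] //.
  by apply: (subsetP sub_O); apply: imset_f.
- by move=> b /setU1P[->|/tgt_O].
exact: through_notin.
Qed.

Lemma noncrossing_set0 : noncrossing (set0 : {set arc n}).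
Proof. by apply/and3P; split; apply/forall_inP => a; rewrite in_set0. Qed.

(* This is cyclic parenthesis matching. *)
Lemma noncrossing_sources O : (#|O| < n)%N ->
  exists2 D, noncrossing D & sources D = O.
Proof.
move=> lt_On.
have [D [D_nc sub_O _ cD]] : exists D, [/\ noncrossing D, sources D \subset O,
    (forall a, a \in D -> a.2 \notin O) & #|D| = #|O|].
  suff: forall d, (d <= #|O|)%N -> exists D, [/\ noncrossing D,
      sources D \subset O, (forall a, a \in D -> a.2 \notin O) & #|D| = d].
    by apply.
  elim=> [_|d IHd lt_dO].
    exists set0; rewrite noncrossing_set0 cards0 /sources imset0 sub0set.
    by split=> // a; rewrite in_set0.
  have [D [D_nc sub_O tgt_O cD]] := IHd (ltnW lt_dO).
  have [|a [nc sub tgt aD]] := add_source D_nc sub_O tgt_O.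
    by rewrite cD lt_dO.
  by exists (a |: D); rewrite cardsU1 aD cD.
exists D => //; apply/eqP; rewrite eqEcard sub_O card_sources // cD.
exact: leqnn.
Qed.

End Sources.

Section FourEnds.

Variable n : nat.
Hypothesis n_ge2 : (2 <= n)%N.
Implicit Types (D : {set arc n}) (S : {set point n}) (t : point n).

Definition four_ended : {set {set arc n}} :=
  [set D : {set arc n} | (#|D| == n - 2)%N && noncrossing D].

(** By parenthesis matching every set of [n - 2] points is the set of sources of some four-ended
    connection. *)
Lemma card_four_ended : ('C(2 * n, n - 2) <= #|four_ended|)%N.
Proof.
rewrite -[X in 'C(X, _)](card_ord (2 * n)) -card_draws.
apply: leq_trans (leq_imset_card (@sources n) _).
apply: subset_leq_card; apply/subsetP => O; rewrite inE => /eqP cO.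
have [|D D_nc DO] := noncrossing_sources (O := O); first by rewrite cO; lia.
by rewrite -DO; apply: imset_f; rewrite inE D_nc andbT -card_sources // DO cO.
Qed.

Lemma four_ended_ends D : D \in four_ended -> exists p0 p1 p2 p3,
  enum (through D) = [:: p0; p1; p2; p3] /\ (p0 < p1 < p2)%N /\ (p2 < p3)%N.
Proof.
rewrite inE => /andP[/eqP cD D_nc].
have size4 : size (enum (through D)) = 4%N.
  by rewrite -cardE; have := card_through D_nc; lia.
have : sorted (relpre val ltn) (enum (through D)).
  rewrite {1}/(enum _) /enum_mem -enumT; apply: sorted_filter.
    by move=> y x z /= ; apply: ltn_trans.
  by rewrite -sorted_map val_enum_ord iota_ltn_sorted.
move: size4; case: (enum _) => [|p0 [|p1 [|p2 [|p3 [|]]]]] //= _.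
by move=> /and4P[lt1 lt2 lt3 _]; exists p0, p1, p2, p3; rewrite lt1 lt2.
Qed.

Variable x0 : point n.

Definition end_ D (j : nat) : point n := nth x0 (enum (through D)) j.

(* The arc from the end preceding the [j]-th one; the arc for [j = 0] passes
   from the last marked point to the first one. *)
Definition closing D (j : nat) : arc n := (end_ D ((j + 3) %% 4), end_ D j).

Definition close D (j : nat) : {set arc n} := closing D j |: D.

Lemma closing_through D j : D \in four_ended -> (j < 4)%N ->
  [/\ (closing D j).1 \in through D, (closing D j).2 \in through D &
     (closing D j).1 != (closing D j).2].
Proof.
move=> D4; have [p0 [p1 [p2 [p3 [E [/andP[lt1 lt2] lt3]]]]]] := four_ended_ends D4.
have inT t : t \in [:: p0; p1; p2; p3] -> t \in through D.
  by rewrite -E mem_enum.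
case: j => [|[|[|[|]]]] // _; rewrite /closing /end_ E /=; split.
all: try by apply: inT; rewrite !inE eqxx ?orbT.
all: by rewrite -val_eqE /= ?neq_ltn; lia.
Qed.

Lemma close_noncrossing D j : D \in four_ended -> (j < 4)%N ->
  noncrossing (close D j).
Proof.
move=> D4 lt_j; have [in1 in2 neq] := closing_through D4 lt_j.
have D_nc : noncrossing D by move: D4; rewrite inE => /andP[].
apply: noncrossing_setU1 => // t; rewrite in_under -mem_enum.
have [p0 [p1 [p2 [p3 [E [/andP[lt1 lt2] lt3]]]]]] := four_ended_ends D4.
rewrite E /endpoint /closing /end_ E {in1 in2 neq}.
case: j lt_j => [|[|[|[|]]]] // _ /=; rewrite !inE => /or4P[]/eqP ->;
  rewrite ?eqxx ?orbT //.
all: move: (ltn_ord p0) (ltn_ord p1) (ltn_ord p2) (ltn_ord p3).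
- move: (ccw_spec p3 p1) (ccw_spec p3 p0); lia.
- move: (ccw_spec p3 p2) (ccw_spec p3 p0); lia.
- move: (ccw_spec p0 p2) (ccw_spec p0 p1); lia.
- move: (ccw_spec p0 p3) (ccw_spec p0 p1); lia.
- move: (ccw_spec p1 p0) (ccw_spec p1 p2); lia.
- move: (ccw_spec p1 p3) (ccw_spec p1 p2); lia.
- move: (ccw_spec p2 p0) (ccw_spec p2 p3); lia.
move: (ccw_spec p2 p1) (ccw_spec p2 p3); lia.
Qed.

Lemma closing_notin D j : D \in four_ended -> (j < 4)%N -> closing D j \notin D.
Proof. by move=> D4 lt_j; apply: through_notin; case: (closing_through D4 lt_j). Qed.

Lemma close_Mb D j : D \in four_ended -> (j < 4)%N -> close D j \in Mb n.
Proof.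
move=> D4 lt_j; rewrite Mb_noncrossing close_noncrossing // andbT.
rewrite cardsU1 closing_notin //; move: D4; rewrite inE => /andP[/eqP -> _].
by apply/eqP; lia.
Qed.

(** The arcs across the cut between the last and the first marked point. Of the four closings only
    that with [j = 0] adds one, which makes it the leading term of the relation. *)
Definition seam (A : {set arc n}) : nat := #|[set a in A | (a.2 < a.1)%N]|.

Lemma seam_close D j : D \in four_ended -> (j < 4)%N ->
  seam (close D j) = (seam D + (j == 0%N))%N.
Proof.
move=> D4 lt_j; have [p0 [p1 [p2 [p3 [E [/andP[lt1 lt2] lt3]]]]]] := four_ended_ends D4.
have : ((closing D j).2 < (closing D j).1)%N = (j == 0%N).
  rewrite /closing /end_ E.
  by case: j lt_j => [|[|[|[|]]]] // _ /=; lia.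
rewrite /seam /close; set a := closing D j => a_seam.
case: (j == 0%N) a_seam => a_seam.
  rewrite addn1; have -> : [set b in a |: D | (b.2 < b.1)%N] =
      a |: [set b in D | (b.2 < b.1)%N].
    apply/setP => b; rewrite !inE; case: eqVneq => [->|] //=.
  by rewrite cardsU1 inE (negbTE (closing_notin D4 lt_j)).
rewrite addn0; congr #|pred_of_set _|; apply/setP => b; rewrite !inE.
by case: eqVneq => [->|] //=; rewrite a_seam andbF.
Qed.

(** The added arc can be recovered as the outermost one across the seam: its source is a free end of
    [D], hence smaller than the source of every seam arc of [D]. *)
Lemma close0_inj : {in four_ended &, injective (fun D => close D 0)}.
Proof.
move=> D E D4 E4 eqDE; have [p0 [p1 [p2 [p3 [ED [/andP[lt1 lt2] lt3]]]]]] := four_ended_ends D4.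
have [r0 [r1 [r2 [r3 [EE [/andP[lt1' lt2'] lt3']]]]]] := four_ended_ends E4.
have cD : closing D 0 = (p3, p0) by rewrite /closing /end_ ED.
have cE : closing E 0 = (r3, r0) by rewrite /closing /end_ EE.
have DN := closing_notin D4 (isT : 0 < 4)%N.
have EN := closing_notin E4 (isT : 0 < 4)%N.
have D_nc : noncrossing D by move: D4; rewrite inE => /andP[].
have E_nc : noncrossing E by move: E4; rewrite inE => /andP[].
have [eq_c|neq_c] := eqVneq (closing D 0) (closing E 0).
  by rewrite -(setU1K DN) -(setU1K EN) -/(close D 0) -/(close E 0) eqDE eq_c.
have E_D : (r3, r0) \in D.
  have : closing E 0 \in close D 0 by rewrite eqDE setU11.
  by case/setU1P => [E0|]; [rewrite E0 eqxx in neq_c | rewrite cE].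
have D_E : (p3, p0) \in E.
  have : closing D 0 \in close E 0 by rewrite -eqDE setU11.
  by case/setU1P => [E0|]; [rewrite E0 eqxx in neq_c | rewrite cD].
have p3T : p3 \in through D by rewrite -mem_enum ED !inE eqxx !orbT.
have r3T : r3 \in through E by rewrite -mem_enum EE !inE eqxx !orbT.
have lt_p : (p0 < p3)%N by apply: ltn_trans lt3; apply: ltn_trans lt2.
have lt_r : (r0 < r3)%N by apply: ltn_trans lt3'; apply: ltn_trans lt2'.
have := outside_seam_arc lt_p (through_outside E_nc D_E r3T).
have := outside_seam_arc lt_r (through_outside D_nc E_D p3T).
by move=> /ltn_trans lt /lt; rewrite ltnn.
Qed.

Variables (R : comNzRingType) (q q' : R).
Hypothesis qq' : q * q' = 1.

Lemma compatible_close D j S :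
  compatible (close D j) S =
  [&& [forall a in D, (a.1 \in S) (+) (a.2 \in S)],
      ((closing D j).1 \in S) (+) ((closing D j).2 \in S) &
      all (fun v => endpoint (closing D j) v || (v \notin S)) (enum (through D))].
Proof.
rewrite /compatible.
have -> : [forall a in close D j, (a.1 \in S) (+) (a.2 \in S)] =
    (((closing D j).1 \in S) (+) ((closing D j).2 \in S)) &&
    [forall a in D, (a.1 \in S) (+) (a.2 \in S)].
  apply/forall_inP/andP => [H|[Ha /forall_inP H] b /setU1P[->|/H]] //.
  split; first by apply: H; rewrite setU11.
  by apply/forall_inP => b bD; apply: H; rewrite setU1r.
rewrite andbC -andbA andbCA; congr [&& _, _ & _].
apply/forall_inP/allP => H v.
  rewrite mem_enum => vD; case: (boolP (endpoint _ _)) => //= end_v.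
  by apply: H; rewrite through_setU1 vD.
rewrite through_setU1 => /andP[vD end_v]; have := H v.
by rewrite mem_enum (negbTE end_v); apply.
Qed.

Lemma weight_close D j S : D \in four_ended -> (j < 4)%N ->
  weight (close D j) S = (((closing D j).2 \in S) + weight D S)%N.
Proof.
move=> D4 lt_j; rewrite /weight /close; set a := closing D j.
case: (boolP (a.2 \in S)) => aS.
  have -> : [set b in a |: D | b.2 \in S] = a |: [set b in D | b.2 \in S].
    by apply/setP => b; rewrite !inE; case: eqVneq => [->|] //=.
  by rewrite cardsU1 inE (negbTE (closing_notin D4 lt_j)).
congr #|pred_of_set _|; apply/setP => b; rewrite !inE.
by case: eqVneq => [->|] //=; rewrite (negbTE aS) andbF.
Qed.

(* On a state with exactly one of the four ends [p_j], only the two arcs at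
   [p_j] contribute; their contributions cancel, except at [p_3], where they add
   up to a multiple of [1 - q ^ 4]. *)
Lemma close_relation D S : D \in four_ended ->
  exists y, \sum_(j < 4) (- q) ^+ j * state_weight q (close D j) S = (q + q') * y.
Proof.
move=> D4; have [p0 [p1 [p2 [p3 [E [/andP[lt1 lt2] lt3]]]]]] := four_ended_ends D4.
have := enum_uniq (through D); rewrite E /= !inE !negb_or.
case/and4P => /and3P[n01 n02 n03] /andP[n12 n13] n23 _.
have neqs := (negbTE n01, negbTE n02, negbTE n03, negbTE n12, negbTE n13, negbTE n23).
rewrite !big_ord_recr big_ord0 /= add0r /state_weight !compatible_close E.
rewrite !weight_close // /closing /end_ E /= /endpoint /= !eqxx.
rewrite [p1 == p0]eq_sym [p2 == p0]eq_sym [p3 == p0]eq_sym.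
rewrite [p2 == p1]eq_sym [p3 == p1]eq_sym [p3 == p2]eq_sym !neqs.
case: [forall a in D, _] => /=; last by exists 0; rewrite !mulr0 !addr0.
case: (p0 \in S); case: (p1 \in S); case: (p2 \in S); case: (p3 \in S) => /=;
  try by exists 0; rewrite !mulr0 !addr0.
all: rewrite ?mulr0 ?addr0 ?add0r ?add0n ?add1n.
all: try by exists 0; rewrite !exprS; ring.
(* Only [p3] is in [S]: with [w = weight D S], closings 0 and 3 give [q ^ w - q ^ 3 * q ^ (w + 1)],
   and [(q + q') * q * (1 - q ^ 2) = 1 - q ^ 4]. *)
exists (q * (1 - q ^+ 2) * q ^+ weight D S).
have -> : (q + q') * (q * (1 - q ^+ 2) * q ^+ weight D S) =
  (q ^+ 2 + q * q') * (1 - q ^+ 2) * q ^+ weight D S by ring.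
by rewrite qq' !exprS; ring.
Qed.

End FourEnds.

(** * Divisibility of the determinant *)

(** A permutation other than the identity with a nonzero product would strictly lower the total of
    [h], although it only permutes the summands. *)
Lemma det_unitriangular (R : comNzRingType) (m : nat) (P : 'M[R]_m) (h : 'I_m -> nat) :
  (forall i, P i i = 1) -> (forall i j, i != j -> P i j != 0 -> (h j < h i)%N) ->
  \det P = 1.
Proof.
move=> diag tri; rewrite /determinant (bigD1 (1%g : 'S_m)) //= odd_perm1 mul1r.
rewrite big1 => [|i _]; last by rewrite perm1.
rewrite big1 ?addr0 // => s s_neq1; have [i Pi] : exists i, P i (s i) = 0.
  apply/exists_eqP; move: s_neq1; apply: contraNT.
  rewrite negb_exists => /forallP nz; apply/eqP/permP => i; rewrite perm1.
  have le j : (h (s j) <= h j)%N.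
    have [->|neq] := eqVneq (s j) j; first by [].
    by apply/ltnW/tri; rewrite ?nz // eq_sym.
  apply/eqP/negPn/negP => neq.
  have : (\sum_j h (s j) < \sum_j h j)%N.
    rewrite [X in (X < _)%N](bigD1 i) // [X in (_ < X)%N](bigD1 i) //=.
    rewrite -addSn leq_add ?leq_sum //.
    by apply: tri; rewrite ?nz // eq_sym.
  by rewrite [X in (_ < X)%N](reindex_inj (@perm_inj _ s)) ltnn.
by rewrite (bigD1 i) //= Pi mul0r mulr0.
Qed.

Section Divisibility.

Variables (n : nat) (R : comNzRingType) (q q' : R).
Hypotheses (n_ge2 : (2 <= n)%N) (qq' : q * q' = 1).

Let n_gt0 : (0 < n)%N := ltnW n_ge2.
Let x0 : point n := Ordinal (ltac:(lia) : 0 < 2 * n)%N.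

Local Notation close := (close x0).
Local Notation four := (four_ended n).

(* The row of [A] is replaced by the relation among the closings of [D] if [A] is
   the closing [close D 0]. *)
Definition relation_of (A : {set arc n}) : option {set arc n} :=
  [pick D | (D \in four) && (close D 0 == A)].

Definition relation_coef (A A' : {set arc n}) : R :=
  if relation_of A is Some D then \sum_(j < 4) (- q) ^+ j * (close D j == A')%:R
  else (A == A')%:R.

Lemma relation_coef_diag A : relation_coef A A = 1.
Proof.
rewrite /relation_coef /relation_of; case: pickP => [D /andP[D4 /eqP D_A]|_].
  rewrite (bigD1 ord0) //= D_A eqxx mulr1 big1 ?addr0 // => j j_neq0.
  case: eqP => [E|_]; last by rewrite mulr0.
  have := seam_close n_ge2 x0 D4 (ltn_ord j).
  rewrite E -D_A (seam_close n_ge2 x0 D4) // eqxx.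
  have -> : ((j : nat) == 0%N) = false by apply: negbTE.
  lia.
by rewrite eqxx.
Qed.

Lemma relation_coef_tri A A' : A != A' -> relation_coef A A' != 0 ->
  (seam A' < seam A)%N.
Proof.
move=> neq; rewrite /relation_coef /relation_of.
case: pickP => [D /andP[D4 /eqP D_A]|_]; last by rewrite (negbTE neq) eqxx.
rewrite -D_A (seam_close n_ge2 x0 D4) // addn1 => nz.
have /existsP[j /eqP j_A'] : [exists j : 'I_4, close D j == A'].
  move: nz; apply: contraNT; rewrite negb_exists => /forallP none.
  by rewrite big1 // => j _; rewrite (negbTE (none j)) mulr0.
rewrite -j_A' (seam_close n_ge2 x0 D4) //.
suff -> : ((j : nat) == 0%N) = false by rewrite addn0.
by apply/negP => /eqP j0; move: neq; rewrite -D_A -j_A' j0 eqxx.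
Qed.

Lemma relation_divides A S : A \in Mb n -> exists y,
  \sum_(A' in Mb n) relation_coef A A' * state_weight q A' S =
  (if relation_of A then q + q' else 1) * y.
Proof.
move=> A_Mb; rewrite /relation_coef /relation_of.
case: pickP => [D /andP[D4 _]|_] /=; last first.
  exists (state_weight q A S); rewrite mul1r (bigD1 A) //= eqxx mul1r.
  rewrite big1 ?addr0 // => A' /andP[_ neq].
  by rewrite eq_sym (negbTE neq) mul0r.
have [y yE] := close_relation n_ge2 x0 qq' S D4; exists y; rewrite -yE.
under eq_bigr do rewrite big_distrl /=.
rewrite exchange_big /=; apply: eq_bigr => j _.
rewrite (bigD1 (close D j)) /=; last exact: close_Mb.
rewrite eqxx mulr1 big1 ?addr0 // => A' /andP[_ neq].
by rewrite eq_sym (negbTE neq) mulr0 mul0r.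
Qed.

Definition gram_at : 'M[R]_#|Mb n| :=
  \matrix_(i, j) (if nb_right (enum_val i) (enum_val j) == 0%N
    then (q + q') ^+ nb_trivial (enum_val i) (enum_val j) else 0).

Lemma card_relations : #|[set A in Mb n | relation_of A]| = #|four|.
Proof.
rewrite -(card_in_imset (@close0_inj n n_ge2 x0)); congr #|pred_of_set _|.
apply/setP => A; rewrite inE /relation_of; apply/andP/imsetP => [[_]|[D D4 ->]].
  by case: pickP => // D /andP[D4 /eqP <-] _; exists D.
split; first exact: close_Mb.
by case: pickP => // /(_ D); rewrite D4 eqxx.
Qed.

Lemma det_gram_at : exists y, \det gram_at = (q + q') ^+ (2 * 'C(2 * n, n - 2)) * y.
Proof.
pose Phi : 'M[R]_(#|Mb n|, #|{set point n}|) :=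
  \matrix_(i, j) state_weight q (enum_val i) (enum_val j).
pose P : 'M[R]_#|Mb n| := \matrix_(i, j) relation_coef (enum_val i) (enum_val j).
pose c (i : 'I_#|Mb n|) : R := if relation_of (enum_val i) then q + q' else 1.
have gramE : Phi *m Phi^T = q ^+ n.-1 *: gram_at.
  apply/matrixP => i j; rewrite !mxE.
  rewrite -(gram_state_sum n_gt0 (enum_valP i) (enum_valP j) qq').
  rewrite [RHS](big_enum_val (A := {set point n})) /=.
  by apply: eq_bigr => k _; rewrite !mxE.
have detP : \det P = 1.
  apply: (det_unitriangular (h := fun i => seam (enum_val i))) => [i|i j neq].
    by rewrite mxE relation_coef_diag.
  by rewrite mxE => /relation_coef_tri; apply; rewrite (inj_eq enum_val_inj).
have ex_y (ik : 'I_#|Mb n| * 'I_#|{set point n}|) :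
    exists y, (P *m Phi) ik.1 ik.2 = c ik.1 * y.
  case: ik => i k /=; rewrite mxE /c.
  have [y yE] := relation_divides (enum_val k) (enum_valP i); exists y.
  by rewrite -yE [RHS]big_enum_val; apply: eq_bigr => j _; rewrite !mxE.
have [Y YE] := fin_all_exists ex_y.
(* [Z] is rectangular, but [Z *m Z^T] is square and has a determinant. *)
pose Z : 'M[R]_(#|Mb n|, #|{set point n}|) := \matrix_(i, k) Y (i, k).
have PPhi : P *m Phi = diag_mx (\row_i c i) *m Z.
  apply/matrixP => i k; rewrite (YE (i, k)) mul_diag_mx !mxE.
  by [].
have detc : \det (diag_mx (\row_i c i)) = (q + q') ^+ #|four|.
  rewrite det_diag -card_relations -prodr_const.
  transitivity (\prod_(A in Mb n) (if relation_of A then q + q' else 1)).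
    by rewrite [RHS]big_enum_val; apply: eq_bigr => i _; rewrite mxE.
  rewrite big_mkcond [RHS]big_mkcond; apply: eq_bigr => A _.
  by rewrite inE; case: (A \in Mb n).
have : \det (P *m Phi *m (P *m Phi)^T) = q ^+ (n.-1 * #|Mb n|) * \det gram_at.
  rewrite trmx_mul mulmxA -(mulmxA P) gramE !det_mulmx det_tr detP mul1r mulr1.
  by rewrite detZ exprM.
rewrite PPhi trmx_mul mulmxA -(mulmxA (diag_mx _)) !det_mulmx det_tr detc => E.
have [k kE] : exists k, #|four| = ('C(2 * n, n - 2) + k)%N.
  by exists (#|four| - 'C(2 * n, n - 2))%N; rewrite subnKC // card_four_ended.
(* The number [k] counts surplus relations, and the power of [q'] undoes the factor [q ^ (n - 1)] in
   each of the rows. *)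
exists ((q + q') ^+ (2 * k) * \det (Z *m Z^T) * q' ^+ (n.-1 * #|Mb n|)).
have qm : q ^+ (n.-1 * #|Mb n|) * q' ^+ (n.-1 * #|Mb n|) = 1.
  by rewrite -exprMn qq' expr1n.
rewrite -[LHS]mulr1 -qm mulrCA mulrA -E mulrA; congr (_ * _).
by rewrite mulrA -exprD -mulnDr -kE mulrAC -exprD addnn -mul2n.
Qed.

End Divisibility.

(** * Adjoining [q] with [d = q + 1 / q] *)

Section Specialization.

Variable B : comNzRingType.
Variable d : B.

Let h : {poly B} := 'X^2 - d *: 'X + 1.

Let h_size : size h = 3%N.
Proof.
rewrite /h -addrA size_polyDl size_polyXn // ltnS.
apply: leq_trans (size_polyD _ _) _; rewrite geq_max size_polyN size_poly1 andbT.
by apply: leq_trans (size_scale_leq _ _) _; rewrite size_polyX.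
Qed.

Let h_monic : h \is monic.
Proof.
rewrite monicE lead_coefE h_size /h !coefE /=.
by rewrite mulr0 subr0 addr0.
Qed.

Let h_mk : mk_monic h = h.
Proof. by rewrite /mk_monic h_size h_monic. Qed.

Let h_root : in_qpoly h h = 0.
Proof. by apply: val_inj; rewrite /= h_mk Pdiv.RingMonic.rmodpp. Qed.

(* [R] is [B[q] / (q ^ 2 - d q + 1)], free over [B] with basis [1, q]. *)
Lemma quantum_parameter : exists (R : comNzRingType) (f : {rmorphism B -> R})
    (q q' : R), [/\ q * q' = 1, q + q' = f d &
      forall (a b : B) (r : R), f a = f b * r -> exists b', a = b * b'].
Proof.
exists ({poly %/ h} : comNzRingType), (qpolyC h).
(* From [q ^ 2 - d q + 1 = 0], the inverse of [q] is [d - q]. *)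
exists (in_qpoly h 'X), (in_qpoly h (d%:P - 'X)); split.
- rewrite -rmorphM /= -[RHS](rmorph1 (in_qpoly h)) -[LHS]addr0 -h_root -rmorphD.
  by congr (in_qpoly h _); rewrite /h -mul_polyC; ring.
- rewrite -rmorphD addrC subrK; apply: val_inj.
  rewrite /= Pdiv.CommonRing.rmodp_small // h_mk h_size.
  exact: leq_ltn_trans (size_polyC_leq1 _) _.
move=> a b r /(congr1 val) /=; rewrite mul_polyC.
rewrite Pdiv.CommonRing.rmodp_small; last first.
  by apply: leq_ltn_trans (size_scale_leq _ _) _; apply: size_mk_monic.
move/(congr1 (fun p : {poly B} => p`_0)); rewrite coefC coefZ /= => ->.
(* Both [f a] and [f b] are constants, so comparing the constant coefficients gives the quotient in
   [B]. *)
by exists (val r)`_0.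
Qed.

End Specialization.

(** If no curve passes through the second crosscap alone, one curve uses both crosscaps. It leaves
    none to be counted by [x], and no curve can separate the crosscaps that it connects, so [z]
    disappears as well. *)
Lemma subst_form n (A B : {set arc n}) : (2 <= n)%N ->
  A \in Mb n -> B \in Mb n ->
  subst_y0_w1 (Mb_form A B) =
  if nb_right A B == 0%N then qd ^+ nb_trivial A B else 0.
Proof.
move=> n_ge2 A_Mb B_Mb; have n_gt0 := ltnW n_ge2.
rewrite /subst_y0_w1 /Mb_form !rmorphM !rmorphXn /=.
rewrite /pd /px /py /pz /pw /var5 !comp_mpolyXU /= expr1n mulr1.
case: eqVneq => [no_right|/negbTE n0]; last by rewrite expr0n n0 mulr0 mul0r.
have [left0 sep0] := no_right_no_left n_gt0 A_Mb B_Mb no_right.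
by rewrite no_right left0 sep0 !expr0 !mulr1.
Qed.

Theorem theorem3p6 (n : nat) (n_ge2 : (2 <= n)%N) :
  exists q : {mpoly int[3]},
    \det (gram_tilde n) = q * chebyshevS 1 qd ^+ (2 * 'C(2 * n, n - 2)).
Proof.
have [R [f [q [q' [qq' qqd cancel]]]]] := quantum_parameter qd.
have [y yE] := det_gram_at n_ge2 qq'.
have gramE : map_mx f (gram_tilde n) = gram_at n q q'.
  apply/matrixP => i j; rewrite !mxE subst_form ?enum_valP //.
  by case: ifP => _; rewrite ?rmorph0 // rmorphXn qqd.
have [r rE] : exists r, \det (gram_tilde n) = qd ^+ (2 * 'C(2 * n, n - 2)) * r.
  by apply: (cancel _ _ y); rewrite -det_map_mx gramE yE rmorphXn qqd.
by exists r; rewrite rE mulrC.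
Qed.
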